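(* (Stage comparison) There is a partial functional $P$ in two variables, computable in $\mathcal{I}$, such that for all tuples $\langle e,\vec F,\vec f,\vec a\rangle$ and $\langle d,\vec G,\vec g,\vec c\rangle$ (with $e,d\in\mathbb{N}$; $\vec F,\vec G$ finite sequences of total functionals $\mathbb{N}^{\mathbb{N}}\to\mathbb{N}$; $\vec f,\vec g$ finite sequences from $\mathbb{N}^{\mathbb{N}}$; $\vec a,\vec c$ finite sequences from $\mathbb{N}$): (i) $P(\langle e,\vec F,\vec f,\vec a\rangle,\langle d,\vec G,\vec g,\vec c\rangle)$ terminates if at least one of $\langle e,\vec F,\vec f,\vec a\rangle$ and $\langle d,\vec G,\vec g,\vec c\rangle$ is in $C_{\mathcal{I}}$, and then (ii) $P(\langle e,\vec F,\vec f,\vec a\rangle,\langle d,\vec G,\vec g,\vec c\rangle)=1$ if $\|\langle e,\vec F,\vec f,\vec a\rangle\|\le\|\langle d,\vec G,\vec g,\vec c\rangle\|$; (iii) $P(\langle e,\vec F,\vec f,\vec a\rangle,\langle d,\vec G,\vec g,\vec c\rangle)=0$ if $\|\langle d,\vec G,\vec g,\vec c\rangle\|<\|\langle e,\vec F,\vec f,\vec a\rangle\|$.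
   Context: Non-monotone induction. Let $C=\{0,1\}^{\mathbb{N}}$ with the pointwise order. For a possibly partial $F:C\to C$ (each $F(f)$ is an element of $C$ or undefined) define $f_0$ = constant $0$, $f_{\beta+1}=\max\{f_\beta,F(f_\beta)\}$, $f_\beta=\sup_{\gamma<\beta}f_\gamma$ for limit $\beta$, where for $\beta>0$, $f_\beta$ is defined iff $f_\gamma$ and $F(f_\gamma)$ are defined for all $\gamma<\beta$. $\mathcal{I}(F)$ is defined iff there is $\alpha$ with $f_{\alpha+1}$ defined and $f_\alpha=f_{\alpha+1}$; then, for the least such $\alpha$, $\mathcal{I}(F)=f_\alpha$. For possibly partial $G:\mathbb{N}^{\mathbb{N}}\to\mathbb{N}$ let $F_G(f)(n)=\min\{G(n^\frown f),1\}$ for $f\in C$, where $(n^\frown f)(0)=n$, $(n^\frown f)(k+1)=f(k)$; $F_G(f)$ is defined iff all $G(n^\frown f)$ are. Kleene computability. $\{e\}(\mathcal{I},\vec F,\vec f,\vec a)=c$ is the least relation given by: S1: $e=\langle1\rangle$, value $a_1+1$. S2: $e=\langle2,q\rangle$, value $q$. S3: $e=\langle3\rangle$, value $a_1$. S4: $e=\langle4,e_1,e_2\rangle$, value $\{e_1\}(\mathcal{I},\vec F,\vec f,b,\vec a)$ where $b=\{e_2\}(\mathcal{I},\vec F,\vec f,\vec a)$. S6: $e=\langle6,e_1,\tau_1,\tau_2,\tau_3\rangle$, value $\{e_1\}(\mathcal{I},\vec F_{\tau_1},\vec f_{\tau_2},\vec a_{\tau_3})$ ($\tau_i$ permutations of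 index sets). S7: $e=\langle7\rangle$, value $f_1(a_1)$. S8.2: $e=\langle8,2,d\rangle$, value $F_1(g)$ when $g(a)=\{d\}(\mathcal{I},\vec F,\vec f,a,\vec a)$ is total. S8.3: $e=\langle8,3,d\rangle$, $\{e\}(\mathcal{I},\vec F,\vec f,b,\vec a)=\mathcal{I}(F_G)(b)$ where $G(h)=\{d\}(\mathcal{I},\vec F,h,\vec f,\vec a)$, provided $\mathcal{I}(F_G)$ is defined. S9: $e=\langle9\rangle$, $\{e\}(\mathcal{I},\vec F,\vec f,d,\vec a)=\{d\}(\mathcal{I},\vec F,\vec f,\vec a)$. (These are the paper's ''$p$-computations''.) A partial functional is computable in $\mathcal{I}$ if it is given by $\{e\}(\mathcal{I},\cdot)$ for some index $e$. $C_{\mathcal{I}}$ is the set of sequences $\langle e,\vec F,\vec f,\vec a\rangle$ such that $\{e\}(\mathcal{I},\vec F,\vec f,\vec a)=b$ for some $b$. The norm $\|\cdot\|$ on $C_{\mathcal{I}}$ is defined by transfinite recursion: it is $0$ for S1, S2, S3, S7; for S4, $\|\langle e,\vec F,\vec f,\vec a\rangle\|=\max\{\|\langle e_2,\vec F,\vec f,\vec a\rangle\|,\|\langle e_1,\vec F,\vec f,c,\vec a\rangle\|\}+1$ where $c=\{e_2\}(\mathcal{I},\vec F,\vec f,\vec a)$; for S6 and S9 it is the norm of the immediate subcomputation plus $1$; for S8.2 it is $\sup\{\|\langle d,\vec F,\vec f,b,\vec a\rangle\|+1:b\in\mathbb{N}\}$; for S8.3, with $(f_\beta)_{\beta\le\alpha}$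 the sequence generated by $F_G$ up to the least $\alpha$ with $F_G(f_\alpha)\le f_\alpha$, it is $\sup\{\|\langle d,\vec F,c^\frown f_\beta,\vec f,\vec a\rangle\|+1:\beta\le\alpha,\ c\in\mathbb{N}\}$. If $\langle e,\vec F,\vec f,\vec a\rangle\notin C_{\mathcal{I}}$, then $\|\langle e,\vec F,\vec f,\vec a\rangle\|=\aleph_1$. *)

(* Defs.v *)
From mathcomp Require Import all_boot.
From mathcomp Require Import boolp.
From Stdlib Require Cantor.

Set Implicit Arguments.
Unset Strict Implicit.
Unset Printing Implicit Defensive.

(** * Ordinals *)

(* [Sup x] stands for the ordinal sup {x i + 1 | i : A}.  Distinct terms can
   stand for the same ordinal: equality of ordinals is [oeq]. *)
Inductive ord : Type := Sup (A : Type) (x : A -> ord).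

Fixpoint ole (x y : ord) : Prop :=
  match x, y with
  | @Sup A f, @Sup B g => forall i : A, exists j : B, ole (f i) (g j)
  end.

Definition olt (x y : ord) : Prop :=
  match y with @Sup B g => exists j : B, ole x (g j) end.

Definition oeq (x y : ord) : Prop := ole x y /\ ole y x.

Definition ozero : ord := Sup (fun i : False => match i with end).

Definition osucc (x : ord) : ord := Sup (fun _ : unit => x).

Definition omax (x y : ord) : ord :=
  match x, y with
  | @Sup A f, @Sup B g =>
      Sup (fun k : A + B => match k with inl i => f i | inr j => g j end)
  end.

Definition olimit (x : ord) : Prop :=
  ~ oeq x ozero /\ ~ exists y, oeq x (osucc y).

Fixpoint acc_rank (T : Type) (R : T -> T -> Prop) (x : T) (Hx : Acc R x) : ord :=
  Sup (fun y : {y | R y x} => acc_rank (Acc_inv Hx (svalP y))).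

(* The least ordinal above the ranks of all well-founded relations on nat,
   that is, above all countable ordinals. *)
Definition aleph1 : ord :=
  Sup (fun R : {R : nat -> nat -> Prop | well_founded R} =>
    Sup (fun n => acc_rank (svalP R n))).

Lemma ole_refl x : ole x x.
Proof. by elim: x => A f IH /= i; exists i; apply: IH. Qed.

Lemma ole_trans y x z : ole x y -> ole y z -> ole x z.
Proof.
elim: x y z => A f IH [B g] [C h] /= xy yz i.
have [j fg] := xy i; have [k gh] := yz j.
by exists k; apply: IH fg gh.
Qed.

Lemma ole_olt_trans y x z : ole x y -> olt y z -> olt x z.
Proof. by case: z => C h xy [k yh]; exists k; apply: ole_trans xy yh. Qed.

Lemma olt_ole_trans y x z : olt x y -> ole y z -> olt x z.
Proof.
case: y z => [B g] [C h] [j xg] /(_ j)[k gh].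
by exists k; apply: ole_trans xg gh.
Qed.

Lemma olt_irrefl x : ~ olt x x.
Proof.
elim: x => A f IH [i fi]; apply: (IH i).
apply: olt_ole_trans fi; by exists i; apply: ole_refl.
Qed.

Lemma olt_ole x y : olt x y -> ole x y.
Proof.
elim: x y => A f IH [B g] [j fg] i /=; exists j; apply: IH.
apply: olt_ole_trans fg; by exists i; apply: ole_refl.
Qed.

Lemma ole_or_olt x y : ole x y \/ olt y x.
Proof.
elim: x y => A f IH [B g].
have [|/existsNP[i ni]] := pselect (forall i, exists j, ole (f i) (g j)).
  by left.
right; exists i; case: (f i) (IH i) ni => C h IHi ni j.
by case: (IHi (g j)) => // fg; case: ni; exists j.
Qed.

Lemma olt_oeq_or_gt x y : [\/ olt x y, oeq x y | olt y x].
Proof.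
case: (ole_or_olt x y) => [xy|]; last by constructor 3.
by case: (ole_or_olt y x) => [yx|]; [constructor 2|constructor 1].
Qed.

Lemma oeq_refl x : oeq x x.
Proof. by split; apply: ole_refl. Qed.

Lemma oeq_sym x y : oeq x y -> oeq y x. Proof. by case. Qed.

Lemma oeq_trans y x z : oeq x y -> oeq y z -> oeq x z.
Proof.
by move=> [xy yx] [yz zy]; split; [apply: ole_trans yz|apply: ole_trans yx].
Qed.

Lemma olt_succ x : olt x (osucc x).
Proof. by exists tt; apply: ole_refl. Qed.

Lemma osucc_neq0 x : ~ oeq (osucc x) ozero.
Proof. by case=> /(_ tt)[[]]. Qed.

Lemma osucc_inj x y : oeq (osucc x) (osucc y) -> oeq x y.
Proof. by case=> /(_ tt)[_ xy] /(_ tt)[_ yx]. Qed.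

Lemma oeq_lt x y z : oeq x y -> olt z x -> olt z y.
Proof. by move=> [xy _] zx; apply: olt_ole_trans xy. Qed.

(** * Non-monotone induction *)

Definition cantor := nat -> bool.

Definition cle (f g : cantor) : Prop := forall n, f n <= g n.

Definition cmax (f g : cantor) : cantor := fun n => f n || g n.

Section Induction.

(* The graph of a partial map from [cantor] to [cantor]. *)
Variable F : cantor -> cantor -> Prop.

(* [stage b f]: f_b is defined and equal to f. *)
Inductive stage : ord -> cantor -> Prop :=
| stage_zero b :
    oeq b ozero -> stage b (fun _ => false)
| stage_succ b c f g :
    oeq b (osucc c) -> stage c f -> F f g -> stage b (cmax f g)
| stage_limit b (s : ord -> cantor) (f : cantor) :
    olimit b ->
    (forall c, olt c b -> stage c (s c)) ->
    (forall c, olt c b -> exists g, F (s c) g) ->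
    (forall n : nat, f n <-> exists2 c, olt c b & s c n) ->
    stage b f.

(* [ind_val f]: the value of non-monotone induction on F is defined and equal
   to f.  The minimality of a is phrased positively, since [ind_val] is used
   inside an inductive definition; it is equivalent to the negative phrasing
   because all stages up to the successor of a are defined. *)
Definition ind_val (f : cantor) : Prop :=
  exists a, [/\ stage a f, stage (osucc a) f &
    forall b, olt b a ->
      exists g h, [/\ stage b g, stage (osucc b) h & g <> h]].

Definition closed_stage (a : ord) : Prop :=
  exists f g, [/\ stage a f, F f g & cle g f].

Definition closure_ord (a : ord) : Prop :=
  closed_stage a /\ forall b, olt b a -> ~ closed_stage b.

End Induction.

Section StageMono.

Variables F1 F2 : cantor -> cantor -> Prop.
Hypothesis F12 : forall f g, F1 f g -> F2 f g.

Definition stage_mono : forall b f, stage F1 b f -> stage F2 b f :=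
  fix loop b f (H : stage F1 b f) : stage F2 b f :=
    match H with
    | stage_zero b b0 => stage_zero F2 b0
    | stage_succ b c f g bc Hf Hg => stage_succ bc (loop c f Hf) (F12 Hg)
    | stage_limit b s f bl Hs Hg Hf =>
        stage_limit bl (fun c cb => loop c (s c) (Hs c cb))
          (fun c cb => match Hg c cb with
                       | ex_intro g Hgc => ex_intro _ g (F12 Hgc) end) Hf
    end.

Definition ind_val_mono f (H : ind_val F1 f) : ind_val F2 f :=
  match H with
  | ex_intro a (And3 Ha Hsa Hb) =>
      ex_intro _ a (And3 (stage_mono Ha) (stage_mono Hsa) (fun b ba =>
        match Hb b ba with
        | ex_intro g (ex_intro h (And3 Hg Hh gh)) =>
            ex_intro _ g (ex_intro _ h
              (And3 (stage_mono Hg) (stage_mono Hh) gh))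
        end))
  end.

End StageMono.

Section StageFun.

Variables F1 F2 : cantor -> cantor -> Prop.
Hypothesis F12 : forall f g h, F1 f g -> F2 f h -> g = h.

Lemma stage_fun b c f g : stage F1 b f -> stage F2 c g -> oeq b c -> f = g.
Proof.
move=> Hf; elim: Hf c g => {b f} [b b0|b b' f f' bb' _ IH Hf'|b s f [b0 bS] _ IH _ Hf].
- move=> c g [{}c _ //|{}c c' h h' cc' _ _|{}c t {}g [c0 _] _ _ _] bc.
  + by case: (@osucc_neq0 c'); apply: oeq_trans (oeq_trans (oeq_sym bc) b0); apply: oeq_sym.
  + by case: c0; apply: oeq_trans b0; apply: oeq_sym.
- move=> c g [{}c c0|{}c c' h h' cc' Hh Hh'|{}c t {}g [_ cS] _ _ _] bc.
  + by case: (@osucc_neq0 b'); apply: oeq_trans c0; apply: oeq_trans bc; apply: oeq_sym.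
  + have fh : f = h.
      apply: (IH _ _ Hh); apply: osucc_inj; apply: oeq_trans cc'.
      by apply: oeq_trans bc; apply: oeq_sym.
    by subst h; rewrite (F12 Hf' Hh').
  + by case: cS; exists b'; apply: oeq_trans bb'; apply: oeq_sym.
- move=> c g [{}c c0|{}c c' h h' cc' _ _|{}c t {}g _ Ht _ Hg] bc.
  + by case: b0; apply: oeq_trans c0.
  + by case: bS; exists c'; apply: oeq_trans cc'.
  + have st d : olt d b -> s d = t d.
      move=> db; apply: (IH _ db _ _ (Ht _ (oeq_lt bc db))).
      by split; apply: ole_refl.
    apply/funext => n; apply/idP/idP => [/Hf|/Hg] [d dlt dn].
      by apply/Hg; exists d; [apply: oeq_lt dlt|rewrite -st].
    have db := oeq_lt (oeq_sym bc) dlt.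
    by apply/Hf; exists d => //; rewrite st.
Qed.

End StageFun.

Lemma stage_succ_inv F b h : stage F (osucc b) h ->
  exists c f g, [/\ oeq b c, stage F c f, F f g & h = cmax f g].
Proof.
move E: (osucc b) => sb Hh; case: Hh E => {sb h} [c c0|c c' f g cc' Hf Hg|c s f [_ cS] _ _ _] E; subst c.
- by case: (osucc_neq0 c0).
- by exists c', f, g; split=> //; apply: osucc_inj.
- by case: cS; exists b; split; apply: ole_refl.
Qed.

Lemma cmax_idP f g : cmax f g = f <-> cle g f.
Proof.
split=> [fg n|gf]; first by rewrite -fg /cmax; case: (f n); case: (g n).
by apply/funext => n; rewrite /cmax; move: (gf n); case: (f n); case: (g n).
Qed.

Lemma ind_val_fun F1 F2 f g : (forall f g h, F1 f g -> F2 f h -> g = h) ->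
  ind_val F1 f -> ind_val F2 g -> f = g.
Proof.
move=> F12 [a [af asf amin]] [b [bg bsg bmin]].
have [ab|ab|ba] := olt_oeq_or_gt a b.
- have [u [v [ua va uv]]] := bmin _ ab; case: uv.
  by rewrite -(stage_fun F12 af ua) ?(stage_fun F12 asf va) //; apply: oeq_refl.
- exact: (stage_fun F12 af bg ab).
- have [u [v [ub vb uv]]] := amin _ ba; case: uv.
  by rewrite (stage_fun F12 ub bg) ?(stage_fun F12 vb bsg) //; apply: oeq_refl.
Qed.

(** * Computations *)

Definition fcn := nat -> nat.
Definition fnl := fcn -> nat.

Definition prepend (n : nat) (f : fcn) : fcn :=
  fun k => if k is k'.+1 then f k' else n.

Definition cprepend (n : nat) (f : cantor) : fcn :=
  prepend n (fun k => nat_of_bool (f k)).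

(* The graph of F_G, for G given by its graph. *)
Definition fpart (G : fcn -> nat -> Prop) (f g : cantor) : Prop :=
  forall n, exists y, G (cprepend n f) y /\ nat_of_bool (g n) = minn y 1.

(* The coding of finite sequences of numbers, a bijection.  There is no scheme
   of primitive recursion (S5): definition by cases has to be obtained from S9,
   by choosing between the consecutive indices <3> and <2,0> = <3> + 1. *)
Definition code (s : seq nat) : nat :=
  foldr (fun x c => (Cantor.to_nat (x, c)).+1) 0 s.

Lemma code_inj : injective code.
Proof.
have codeE x s : code (x :: s) = (Cantor.to_nat (x, code s)).+1 by [].
elim=> [|x s IH] [|y t]; rewrite ?codeE // => /succn_inj E.
have := Cantor.cancel_of_to (x, code s).
by rewrite E Cantor.cancel_of_to => -[-> ts]; rewrite (IH t).
Qed.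

(* A finite permutation of the index set {0, 1, 2, ...} is given by the list p
   of its values on an initial segment, beyond which it is the identity; it
   acts on the sequences that are at least as long as p. *)
Definition perm_for (T : Type) (p : seq nat) (s : seq T) : bool :=
  perm_eq p (iota 0 (size p)) && (size p <= size s).

Definition permute (T : Type) (p : seq nat) (s : seq T) : seq T :=
  pmap (onth s) p ++ drop (size p) s.

(* [kleene e F f a c]: {e}(I, F, f, a) = c. *)
Inductive kleene : nat -> seq fnl -> seq fcn -> seq nat -> nat -> Prop :=
| KS1 F f a1 a :
    kleene (code [:: 1]) F f (a1 :: a) a1.+1
| KS2 q F f a :
    kleene (code [:: 2; q]) F f a q
| KS3 F f a1 a :
    kleene (code [:: 3]) F f (a1 :: a) a1
| KS4 e1 e2 F f a b c :
    kleene e2 F f a b -> kleene e1 F f (b :: a) c ->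
    kleene (code [:: 4; e1; e2]) F f a c
| KS6 e1 p1 p2 p3 F f a c :
    perm_for p1 F -> perm_for p2 f -> perm_for p3 a ->
    kleene e1 (permute p1 F) (permute p2 f) (permute p3 a) c ->
    kleene (code [:: 6; e1; code p1; code p2; code p3]) F f a c
| KS7 F f1 f a1 a :
    kleene (code [:: 7]) F (f1 :: f) (a1 :: a) (f1 a1)
| KS82 d F1 F f a (g : fcn) :
    (forall x, kleene d (F1 :: F) f (x :: a) (g x)) ->
    kleene (code [:: 8; 2; d]) (F1 :: F) f a (F1 g)
| KS83 d F f b a g :
    ind_val (fpart (fun h y => kleene d F (h :: f) a y)) g ->
    kleene (code [:: 8; 3; d]) F f (b :: a) (nat_of_bool (g b))
| KS9 d F f a c :
    kleene d F f a c ->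
    kleene (code [:: 9]) F f (d :: a) c.

(* The induction hypothesis for S8.3, which the automatically generated
   principle leaves out, covers the subcomputations used in the induction. *)
Section KleeneInd.

Variable Q : nat -> seq fnl -> seq fcn -> seq nat -> nat -> Prop.
Hypothesis Q1 : forall F f a1 a, Q (code [:: 1]) F f (a1 :: a) a1.+1.
Hypothesis Q2 : forall q F f a, Q (code [:: 2; q]) F f a q.
Hypothesis Q3 : forall F f a1 a, Q (code [:: 3]) F f (a1 :: a) a1.
Hypothesis Q4 : forall e1 e2 F f a b c,
  kleene e2 F f a b -> Q e2 F f a b ->
  kleene e1 F f (b :: a) c -> Q e1 F f (b :: a) c ->
  Q (code [:: 4; e1; e2]) F f a c.
Hypothesis Q6 : forall e1 p1 p2 p3 F f a c,
  perm_for p1 F -> perm_for p2 f -> perm_for p3 a ->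
  kleene e1 (permute p1 F) (permute p2 f) (permute p3 a) c ->
  Q e1 (permute p1 F) (permute p2 f) (permute p3 a) c ->
  Q (code [:: 6; e1; code p1; code p2; code p3]) F f a c.
Hypothesis Q7 : forall F f1 f a1 a,
  Q (code [:: 7]) F (f1 :: f) (a1 :: a) (f1 a1).
Hypothesis Q82 : forall d F1 F f a (g : fcn),
  (forall x, kleene d (F1 :: F) f (x :: a) (g x)) ->
  (forall x, Q d (F1 :: F) f (x :: a) (g x)) ->
  Q (code [:: 8; 2; d]) (F1 :: F) f a (F1 g).
Hypothesis Q83 : forall d F f b a g,
  ind_val (fpart (fun h y => kleene d F (h :: f) a y /\ Q d F (h :: f) a y)) g ->
  Q (code [:: 8; 3; d]) F f (b :: a) (nat_of_bool (g b)).
Hypothesis Q9 : forall d F f a c,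
  kleene d F f a c -> Q d F f a c -> Q (code [:: 9]) F f (d :: a) c.

Definition kleene_strong_ind :
    forall e F f a c, kleene e F f a c -> Q e F f a c :=
  fix loop e F f a c (H : kleene e F f a c) : Q e F f a c :=
    match H with
    | KS1 F f a1 a => Q1 F f a1 a
    | KS2 q F f a => Q2 q F f a
    | KS3 F f a1 a => Q3 F f a1 a
    | KS4 e1 e2 F f a b c H2 H1 => Q4 H2 (loop _ _ _ _ _ H2) H1 (loop _ _ _ _ _ H1)
    | KS6 e1 p1 p2 p3 F f a c h1 h2 h3 H1 => Q6 h1 h2 h3 H1 (loop _ _ _ _ _ H1)
    | KS7 F f1 f a1 a => Q7 F f1 f a1 a
    | KS82 d F1 F f a g Hg => Q82 Hg (fun x => loop _ _ _ _ _ (Hg x))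
    | KS83 d F f b a g Hg =>
        Q83 b (ind_val_mono (fun u v (Huv : fpart _ u v) n =>
          match Huv n with
          | ex_intro y (conj Hy vy) =>
              ex_intro _ y (conj (conj Hy (loop _ _ _ _ _ Hy)) vy)
          end) Hg)
    | KS9 d F f a c H1 => Q9 H1 (loop _ _ _ _ _ H1)
    end.

End KleeneInd.

Lemma kleene_inv s F f a c : kleene (code s) F f a c ->
  match s with
  | [:: 1] => exists a1 a', a = a1 :: a' /\ c = a1.+1
  | [:: 2; q] => c = q
  | [:: 3] => exists a1 a', a = a1 :: a' /\ c = a1
  | [:: 4; e1; e2] => exists2 b, kleene e2 F f a b & kleene e1 F f (b :: a) c
  | [:: 6; e1; t1; t2; t3] => exists p1 p2 p3,
      [/\ t1 = code p1, t2 = code p2 & t3 = code p3] /\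
      [/\ perm_for p1 F, perm_for p2 f, perm_for p3 a &
       kleene e1 (permute p1 F) (permute p2 f) (permute p3 a) c]
  | [:: 7] => exists f1 f' a1 a', [/\ f = f1 :: f', a = a1 :: a' & c = f1 a1]
  | [:: 8; 2; d] => exists F1 F' g, [/\ F = F1 :: F',
      forall x, kleene d F f (x :: a) (g x) & c = F1 g]
  | [:: 8; 3; d] => exists b a' g, [/\ a = b :: a',
      ind_val (fpart (fun h y => kleene d F (h :: f) a' y)) g
      & c = nat_of_bool (g b)]
  | [:: 9] => exists d a', a = d :: a' /\ kleene d F f a' c
  | _ => False
  end.
Proof.
move Es: (code s) => e H; case: H Es => {e F f a c}.
- by move=> F f a1 a /code_inj->; exists a1, a.
- by move=> q F f a /code_inj->.
- by move=> F f a1 a /code_inj->; exists a1, a.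
- by move=> e1 e2 F f a b c H2 H1 /code_inj->; exists b.
- by move=> e1 p1 p2 p3 F f a c h1 h2 h3 H /code_inj->; exists p1, p2, p3.
- by move=> F f1 f a1 a /code_inj->; exists f1, f, a1, a.
- by move=> d F1 F f a g Hg /code_inj->; exists F1, F, g.
- by move=> d F f b a g Hg /code_inj->; exists b, a, g.
- by move=> d F f a c H /code_inj->; exists d, a.
Qed.

Lemma fpart_fun (G1 G2 : fcn -> nat -> Prop) :
  (forall u y z, G1 u y -> G2 u z -> y = z) ->
  forall f g h, fpart G1 f g -> fpart G2 f h -> g = h.
Proof.
move=> G12 f g h fg fh; apply/funext => n.
have [y [Gy gn]] := fg n; have [z [Gz hn]] := fh n.
by move: gn; rewrite (G12 _ _ _ Gy Gz) -hn; case: (g n); case: (h n).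
Qed.

Lemma kleene_fun e F f a c c' : kleene e F f a c -> kleene e F f a c' -> c = c'.
Proof.
move=> H; move: c'; elim/kleene_strong_ind: H => {e F f a c}.
- by move=> F f a1 a c' /kleene_inv[_ [_ [[<- _] ->]]].
- by move=> q F f a c' /kleene_inv.
- by move=> F f a1 a c' /kleene_inv[_ [_ [[<- _] ->]]].
- move=> e1 e2 F f a b c _ IH2 _ IH1 c' /kleene_inv[b' /IH2<-]; exact: IH1.
- move=> e1 p1 p2 p3 F f a c _ _ _ _ IH c' /kleene_inv.
  move=> [q1 [q2 [q3 [[/code_inj<- /code_inj<- /code_inj<-] []]]]] _ _ _.
  exact: IH.
- by move=> F f1 f a1 a c' /kleene_inv[_ [_ [_ [_ [[<- _] [<- _] ->]]]]].
- move=> d F1 F f a g _ IH c' /kleene_inv[_ [_ [h [[<- _] Hh ->]]]].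
  by congr F1; apply/funext => x; apply: IH.
- move=> d F f b a g Hg c' /kleene_inv[_ [_ [h [[<- <-] Hh ->]]]].
  rewrite (@ind_val_fun _ _ g h _ Hg Hh) //.
  by apply: fpart_fun => u y z [_ Hy] /Hy.
- by move=> d F f a c _ IH c' /kleene_inv[_ [_ [[<- <-] /IH]]].
Qed.

(** * The norm *)

Record tup := Tup {
  idx : nat; fnls : seq fnl; fcns : seq fcn; nums : seq nat }.

Definition computes (t : tup) (c : nat) : Prop :=
  kleene (idx t) (fnls t) (fcns t) (nums t) c.

Definition in_CI (t : tup) : Prop := exists c, computes t c.

(* [norm_rel t x]: t is in C_I and its norm is x.  The suprema of S8.2 and
   S8.3 are those of x + 1 over the indexed norms x.  In S8.3 the index set
   consists of the members of the sequence themselves, instead of their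
   indices b <= al, which do not form a set in the universe of [Sup]. *)
Inductive norm_rel : tup -> ord -> Prop :=
| NS1 F f a1 a : norm_rel (Tup (code [:: 1]) F f (a1 :: a)) ozero
| NS2 q F f a : norm_rel (Tup (code [:: 2; q]) F f a) ozero
| NS3 F f a1 a : norm_rel (Tup (code [:: 3]) F f (a1 :: a)) ozero
| NS4 e1 e2 F f a c x y :
    kleene e2 F f a c ->
    norm_rel (Tup e2 F f a) x -> norm_rel (Tup e1 F f (c :: a)) y ->
    norm_rel (Tup (code [:: 4; e1; e2]) F f a) (osucc (omax x y))
| NS6 e1 p1 p2 p3 F f a x :
    perm_for p1 F -> perm_for p2 f -> perm_for p3 a ->
    norm_rel (Tup e1 (permute p1 F) (permute p2 f) (permute p3 a)) x ->
    norm_rel (Tup (code [:: 6; e1; code p1; code p2; code p3]) F f a) (osucc x)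
| NS7 F f1 f a1 a : norm_rel (Tup (code [:: 7]) F (f1 :: f) (a1 :: a)) ozero
| NS82 d F1 F f a (x : nat -> ord) :
    (forall b, norm_rel (Tup d (F1 :: F) f (b :: a)) (x b)) ->
    norm_rel (Tup (code [:: 8; 2; d]) (F1 :: F) f a) (Sup x)
| NS83 d F f b a al (x : cantor -> nat -> ord) :
    let FG := fpart (fun h y => kleene d F (h :: f) a y) in
    closure_ord FG al ->
    (forall be g c, ole be al -> stage FG be g ->
      norm_rel (Tup d F (cprepend c g :: f) a) (x g c)) ->
    norm_rel (Tup (code [:: 8; 3; d]) F f (b :: a))
      (Sup (fun i : {g | exists2 be, ole be al & stage FG be g} * nat =>
              x (sval i.1) i.2))
| NS9 d F f a x :
    norm_rel (Tup d F f a) x ->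
    norm_rel (Tup (code [:: 9]) F f (d :: a)) (osucc x).

Lemma ind_val_closure (F1 F2 : cantor -> cantor -> Prop) g :
  (forall f g, F1 f g -> F2 f g) ->
  (forall f g h, F2 f g -> F2 f h -> g = h) ->
  ind_val F1 g ->
  exists al, closure_ord F2 al /\
    forall be f, ole be al -> stage F2 be f -> exists h, F1 f h.
Proof.
move=> F12 F2f [al [gal gsal almin]].
have F21 f h k : F2 f h -> F1 f k -> h = k by move=> H /F12; apply: F2f.
exists al; split; last first.
  move=> be f beal bef.
  have [k [be' bebe' [h kh]]] :
      exists k, exists2 be', oeq be be' & exists h, stage F1 be' k /\ F1 k h.
    have [lt|eq|gt] := olt_oeq_or_gt be al; last first.
    - by case: (olt_irrefl (olt_ole_trans gt beal)).
    - have [be' [u [v [e us uv _]]]] := stage_succ_inv gsal.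
      by exists u, be'; [apply: oeq_trans e|exists v].
    - have [_ [w [_ /stage_succ_inv[be' [u [v [e us uv _]]]] _]]] := almin _ lt.
      by exists u, be' => //; exists v.
  by exists h; rewrite (stage_fun F21 bef kh.1 bebe'); apply: kh.2.
split.
  have [be' [u [v [e us uv gE]]]] := stage_succ_inv gsal.
  have ug : g = u by apply: (stage_fun _ gal us e) => p q r /F12; apply: F21.
  subst u; exists g, v; split; [exact: stage_mono gal|exact: F12|].
  by apply/cmax_idP; rewrite -gE.
move=> be beal [f [h [bef fh hf]]].
have [u [v [ub vb]]] := almin _ beal; case.
have fu : f = u by apply: (stage_fun F21 bef ub); apply: oeq_refl.
have := stage_succ (oeq_refl _) bef fh; rewrite (cmax_idP f h).2 // => sf.
by rewrite -fu; apply: (stage_fun F21 sf vb); apply: oeq_refl.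
Qed.

Lemma norm_rel_ex t : in_CI t -> exists x, norm_rel t x.
Proof.
case: t => e F f a [c]; rewrite /computes /= => H.
elim/kleene_strong_ind: H => {e F f a c}.
- by move=> *; exists ozero; constructor.
- by move=> *; exists ozero; constructor.
- by move=> *; exists ozero; constructor.
- move=> e1 e2 F f a b c Hb [x Hx] _ [y Hy]; exists (osucc (omax x y)).
  exact: NS4 Hb Hx Hy.
- by move=> e1 p1 p2 p3 F f a c h1 h2 h3 _ [x Hx]; exists (osucc x); constructor.
- by move=> *; exists ozero; constructor.
- by move=> d F1 F f a g _ /choice[x Hx]; exists (Sup x); constructor.
- move=> d F f b a g /ind_val_closure - /(_ (fpart (fun h y => kleene d F (h :: f) a y))).
  case=> [u v uv n|u v w|al [alc Hal]].
  + by have [y [[Hy _] vy]] := uv n; exists y.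
  + by apply: fpart_fun => h y z; apply: kleene_fun.
  pose FG := fpart (fun h y => kleene d F (h :: f) a y).
  pose S (h : cantor) := exists2 be, ole be al & stage FG be h.
  have /choice[x Hx] : forall i : cantor * nat, exists x,
      S i.1 -> norm_rel (Tup d F (cprepend i.2 i.1 :: f) a) x.
    move=> [h n] /=; have [[be beal sh]|nh] := pselect (S h).
      have [k /(_ n)[y [[_ [x Hx]] _]]] := Hal _ _ beal sh.
      by exists x.
    by exists ozero => /nh.
  have NS := @NS83 d F f b a al (fun h n => x (h, n)) alc.
  eexists; apply: NS => be h n beal sh.
  by apply: (Hx (h, n)); exists be.
- by move=> d F f a c _ [x Hx]; exists (osucc x); constructor.
Qed.

Lemma norm_rel_inv s F f a z : norm_rel (Tup (code s) F f a) z ->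
  match s with
  | [:: 1] | [:: 2; _] | [:: 3] | [:: 7] => z = ozero
  | [:: 4; e1; e2] => exists c x y, [/\ kleene e2 F f a c,
      norm_rel (Tup e2 F f a) x, norm_rel (Tup e1 F f (c :: a)) y
      & z = osucc (omax x y)]
  | [:: 6; e1; t1; t2; t3] => exists p1 p2 p3 x,
      [/\ t1 = code p1, t2 = code p2 & t3 = code p3] /\
      [/\ perm_for p1 F, perm_for p2 f, perm_for p3 a,
       norm_rel (Tup e1 (permute p1 F) (permute p2 f) (permute p3 a)) x
       & z = osucc x]
  | [:: 8; 2; d] => exists x : nat -> ord,
      (forall b, norm_rel (Tup d F f (b :: a)) (x b)) /\ z = Sup x
  | [:: 8; 3; d] => exists b a' al (x : cantor -> nat -> ord),
      let FG := fpart (fun h y => kleene d F (h :: f) a' y) in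
      [/\ a = b :: a', closure_ord FG al,
       forall be g c, ole be al -> stage FG be g ->
         norm_rel (Tup d F (cprepend c g :: f) a') (x g c)
       & z = Sup (fun i : {g | exists2 be, ole be al & stage FG be g} * nat =>
                    x (sval i.1) i.2)]
  | [:: 9] => exists d a' x,
      [/\ a = d :: a', norm_rel (Tup d F f a') x & z = osucc x]
  | _ => False
  end.
Proof.
have tup_inj s1 s2 F1 F2 f1 f2 a1 a2 :
    Tup (code s1) F1 f1 a1 = Tup (code s2) F2 f2 a2 ->
    [/\ s1 = s2, F1 = F2, f1 = f2 & a1 = a2].
  move=> E; split; first exact: code_inj (congr1 idx E).
  - exact: (congr1 fnls E).
  - exact: (congr1 fcns E).
  - exact: (congr1 nums E).
move Et: (Tup (code s) F f a) => t H; case: H Et => {t z}.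
- by move=> F' f' a1 a' /tup_inj[-> _ _ _].
- by move=> q F' f' a' /tup_inj[-> _ _ _].
- by move=> F' f' a1 a' /tup_inj[-> _ _ _].
- by move=> e1 e2 F' f' a' c x y Hc Hx Hy /tup_inj[-> -> -> ->]; exists c, x, y.
- move=> e1 p1 p2 p3 F' f' a' x h1 h2 h3 Hx /tup_inj[-> -> -> ->].
  by exists p1, p2, p3, x.
- by move=> F' f1 f' a1 a' /tup_inj[-> _ _ _].
- by move=> d F1 F' f' a' x Hx /tup_inj[-> -> -> ->]; exists x.
- move=> d F' f' b a' al x FG alc Hx /tup_inj[-> -> -> ->].
  by exists b, a', al, x.
- by move=> d F' f' a' x Hx /tup_inj[-> -> -> ->]; exists d, a', x.
Qed.

Lemma closure_ord_fun F a b : closure_ord F a -> closure_ord F b -> oeq a b.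
Proof.
move=> [aF amin] [bF bmin].
by case: (olt_oeq_or_gt a b) => // [/bmin|/amin].
Qed.

Lemma norm_rel_fun t x y : norm_rel t x -> norm_rel t y -> oeq x y.
Proof.
have succE u v : oeq u v -> oeq (osucc u) (osucc v).
  by move=> [uv vu]; split=> i; exists tt.
have maxE u v u' v' : oeq u u' -> oeq v v' -> oeq (omax u v) (omax u' v').
  have le p q p' q' : ole p p' -> ole q q' -> ole (omax p q) (omax p' q').
    move: p q p' q' => [A p] [B q] [A' p'] [B' q'] pp' qq' [i|j].
      by have [k ?] := pp' i; exists (inl k).
    by have [k ?] := qq' j; exists (inr k).
  by move=> [uu' u'u] [vv' v'v]; split; apply: le.
move=> Hx; elim: Hx y => {t x}.
- by move=> F f a1 a y /norm_rel_inv->; apply: oeq_refl.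
- by move=> q F f a y /norm_rel_inv->; apply: oeq_refl.
- by move=> F f a1 a y /norm_rel_inv->; apply: oeq_refl.
- move=> e1 e2 F f a c x y Hc _ IHx _ IHy z /norm_rel_inv.
  move=> [c' [x' [y' [/(kleene_fun Hc) <- /IHx xx' /IHy yy' ->]]]].
  by apply: succE; apply: maxE.
- move=> e1 p1 p2 p3 F f a x _ _ _ _ IH y /norm_rel_inv.
  move=> [q1 [q2 [q3 [x' [[/code_inj<- /code_inj<- /code_inj<-] []]]]]] _ _ _.
  by move=> /IH xx' ->; apply: succE.
- by move=> F f1 f a1 a y /norm_rel_inv->; apply: oeq_refl.
- move=> d F1 F f a x _ IH y /norm_rel_inv[x' [Hx' ->]].
  by split=> i; exists i; have [] := IH i _ (Hx' i).
- move=> d F f b a al x FG alc Hx IH y /norm_rel_inv.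
  move=> [_ [_ [al' [x' [[_ <-] alc' Hx' ->]]]]].
  have [alal' al'al] := closure_ord_fun alc alc'.
  split=> -[[g gs] n] /=.
    have gs' : exists2 be, ole be al' & stage FG be g.
      by have [be ? ?] := gs; exists be => //; apply: ole_trans alal'.
    exists (exist _ g gs', n) => /=.
    have [be beal sg] := gs; have [be' beal' sg'] := gs'.
    by have [] := IH _ _ n beal sg _ (Hx' _ _ n beal' sg').
  have gs' : exists2 be, ole be al & stage FG be g.
    by have [be ? ?] := gs; exists be => //; apply: ole_trans al'al.
  exists (exist _ g gs', n) => /=.
  have [be beal sg] := gs; have [be' beal' sg'] := gs'.
  by have [] := IH _ _ n beal' sg' _ (Hx' _ _ n beal sg).
- move=> d F f a x _ IH y /norm_rel_inv[d' [a' [x' [[<- <-] /IH xx' ->]]]].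
  exact: succE.
Qed.

Lemma norm_ex t :
  exists x, (in_CI t -> norm_rel t x) /\ (~ in_CI t -> x = aleph1).
Proof.
have [Ct|nCt] := pselect (in_CI t); last by exists aleph1.
by have [x Hx] := norm_rel_ex Ct; exists x.
Qed.

Definition norm (t : tup) : ord := sval (cid (norm_ex t)).

(** * Partial functionals of tuples *)

(* A tuple is presented to a computation by its functionals, its functions,
   and a list of numbers that also records how many of each there are; a pair
   of tuples is presented by concatenation. *)
Definition nums_of (t : tup) : seq nat :=
  [:: idx t; size (fnls t); size (fcns t); size (nums t)] ++ nums t.

Definition computable_in_I (P : tup -> tup -> option nat) : Prop :=
  exists p : nat, forall (t u : tup) (c : nat),
    P t u = Some c <->
    kleene p (fnls t ++ fnls u) (fcns t ++ fcns u) (nums_of t ++ nums_of u) c.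

(* Main.v *)
Require Import Defs.
From mathcomp Require Import all_boot.
From mathcomp Require Import boolp zify.

(** |t| <= |u| holds iff |u| <= |t'| fails for every immediate subcomputation
    t' of t. This reduces P(t, u) to the values P(u, t'), and the recursion
    theorem yields an index for P; correctness at (t, u) follows by induction
    on the norm of whichever of t, u is in C_I. If t is an instance of S8.3
    with operator F, the subcomputations n^g are indexed by the stages g of F
    and by n: a second induction with stages (flag, g) follows F as long as
    P(u, n^g) = 0 for all n, and sets the flag and stops otherwise. That it
    closes is Hartogs' argument: each stage before closure adds a new number,
    so that there are only countably many. The arguments of P are coded by
    numbers ("virtual tuples"), so that functions derived from the stages in
    progress can occur in them; they are evaluated by a universal index. *)

Set Implicit Arguments.
Unset Strict Implicit.
Unset Printing Implicit Defensive.

(* Unfolding [code] would compute with large unary numbers. *)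
Opaque code.

(** * Ordinals and stages *)

(** Undefinedness cannot be detected, so a subcomputation t' may be evaluated only after it has been
    found strictly below u; the call P(u, t') tests this safely, as it terminates as soon as one of
    u, t' is in C_I. Tuples outside C_I have norm [aleph1], so the norms in C_I have to be shown
    countable, and for S8.3 this rests on an enumeration of the stages by numbers. In a comparison,
    however, the stages are not given in advance and cannot be searched by a number quantifier: they
    have to be generated while they are tested, and the operator is never applied after a failed
    test. That is what the flag and the non-monotonicity are for. As there is no S5 and the list of
    functionals may be empty, case distinction, arithmetic and number quantification are themselves
    obtained from S8.3 and S9. *)

Lemma ole_oltF x y : ole x y -> olt y x -> False.
Proof. by move=> xy /(ole_olt_trans xy)/olt_irrefl. Qed.

Lemma ole_eqVlt x y : ole x y -> oeq x y \/ olt x y.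
Proof.
by move=> xy; have [|?|/(ole_oltF xy)//] := olt_oeq_or_gt x y; [right|left].
Qed.

Lemma olt_wf : well_founded olt.
Proof.
move=> x; suff : forall y, ole y x -> Acc olt y by apply; apply: ole_refl.
elim: x => A f IH y yx; constructor=> z zy.
by have [i zi] := olt_ole_trans zy yx; apply: (IH i).
Qed.

Lemma ole_succ x y : ole (osucc x) y <-> olt x y.
Proof. by case: y => B g; split=> [/(_ tt)|xg []]. Qed.

Lemma olt_osucc x y : olt x (osucc y) <-> ole x y.
Proof. by split=> [[]|xy]; last exists tt. Qed.

Lemma ozero_le x : ole ozero x.
Proof. by case: x => B g []. Qed.

Lemma ole_Sup A (f : A -> ord) z : ole (Sup f) z <-> forall i, olt (f i) z.
Proof. by case: z => B g; split. Qed.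

Lemma ole_omax x y z : ole (omax x y) z <-> ole x z /\ ole y z.
Proof.
case: x y z => [A f] [B g] [C h]; split=> [H|[H1 H2] [i|j]].
- by split=> i; [apply: (H (inl i))|apply: (H (inr i))].
- exact: H1.
- exact: H2.
Qed.

Lemma olt_omax x y z : olt (omax x y) z <-> olt x z /\ olt y z.
Proof.
case: z => C h; split=> [[k /ole_omax[]]|[[i xi] [j yj]]].
  by split; exists k.
have [ij|/olt_ole ji] := ole_or_olt (h i) (h j).
  by exists j; apply/ole_omax; split=> //; apply: ole_trans ij.
by exists i; apply/ole_omax; split=> //; apply: ole_trans ji.
Qed.

Definition reach F g := exists b, stage F b g.

Lemma cle_trans g f h : cle f g -> cle g h -> cle f h.
Proof. by move=> fg gh n; apply: leq_trans (gh n). Qed.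

Lemma cleP f g : cle f g <-> forall n, f n -> g n.
Proof. by split=> fg n; have := fg n; case: (f n); case: (g n) => //; apply. Qed.

Lemma cle_anti f g : cle f g -> cle g f -> f = g.
Proof.
by move=> fg gf; apply/funext=> n; move: (fg n) (gf n); case: (f n); case: (g n).
Qed.

Lemma cle_cmaxl f g : cle f (cmax f g).
Proof. by move=> n; rewrite /cmax; case: (f n). Qed.

Lemma cle_cmax f g h : cle f h -> cle g h -> cle (cmax f g) h.
Proof. by move=> fh gh n; move: (fh n) (gh n); rewrite /cmax; case: (f n). Qed.

Lemma reach0 F : reach F (fun=> false).
Proof. by exists ozero; constructor; apply: oeq_refl. Qed.

Lemma stage_osucc F b f g : stage F b f -> F f g -> stage F (osucc b) (cmax f g).
Proof. by move=> bf; apply: stage_succ bf; apply: oeq_refl. Qed.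

(** The limit case keeps only that f is a union of stages with the invariant, which hides the
    ordinals from the analysis of programs. *)
Lemma reach_ind F (Inv : cantor -> Prop) :
  Inv (fun=> false) ->
  (forall f g, reach F f -> Inv f -> F f g -> Inv (cmax f g)) ->
  (forall (X : cantor -> Prop) (f : cantor), (forall g, X g -> reach F g /\ Inv g) ->
     (forall n, f n <-> exists2 g, X g & g n) -> Inv f) ->
  forall g, reach F g -> Inv g.
Proof.
move=> I0 IS IL g [b]; elim=> {b g} // [b c f g _ cf If fg|b s f _ Hs IH _ Hf].
  by apply: IS => //; exists c.
apply: (IL (fun g => exists2 c, olt c b & g = s c)) => [g [c cb ->]|n].
  by split; [exists c; apply: Hs|apply: IH].
rewrite Hf; split=> [[c cb cn]|[_ [c cb ->] cn]]; last by exists c.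
by exists (s c) => //; exists c.
Qed.

Section Stages.

Variable F : cantor -> cantor -> Prop.
Hypothesis Ff : forall f g h, F f g -> F f h -> g = h.

Lemma stage_ole b c f g : stage F b f -> stage F c g -> ole b c -> cle f g.
Proof.
move=> bf cg /ole_eqVlt[/(stage_fun Ff bf cg)-> //|].
elim: cg b f bf => {c g} [c c0|c c' g h cc' c'g IH gh|c s g cl Hs IH _ Hg] b f bf bc.
- by case: (ole_oltF (ole_trans c0.1 (ozero_le b)) bc).
- apply: cle_trans (cle_cmaxl _ _).
  have /ole_eqVlt[/(stage_fun Ff bf c'g)-> //|] : ole b c'.
    by apply/olt_osucc; apply: oeq_lt bc.
  exact: IH bf.
- apply/cleP => n fn; apply/Hg; exists b => //.
  by rewrite -(stage_fun Ff bf (Hs _ bc) (oeq_refl _)).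
Qed.

Lemma stage_lt b c f g k : stage F b f -> F f k -> stage F c g -> olt b c ->
  cle (cmax f k) g.
Proof.
move=> bf fk cg bc; apply: (stage_ole (stage_osucc bf fk) cg).
exact/ole_succ.
Qed.

(** A successor step from below [al] stays below f by monotonicity; from [al] on, the stage is f
    itself and the step adds only k. *)
Lemma closed_above al f k be g :
  stage F al f -> F f k -> cle k f -> stage F be g -> cle g f.
Proof.
move=> af fk kf; elim=> {be g} // [be c g h _ cg gf gh|be s g _ _ IH _ Hg].
  have [ac|ca] := ole_or_olt al c; last exact: stage_lt cg gh af ca.
  have gfE : g = f by apply: cle_anti gf (stage_ole af cg ac).
  by subst g; rewrite (Ff gh fk); apply: cle_cmax.
by apply/cleP => n /Hg[c cb sn]; move/cleP: (IH _ cb); apply.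
Qed.

(** A stage beyond a closed one is the closed stage itself, so the stages up to [al], which index
    the norm of S8.3, are all the stages. *)
Lemma reach_closed al f k g :
  stage F al f -> F f k -> cle k f -> reach F g ->
  exists2 be, ole be al & stage F be g.
Proof.
move=> af fk kf [be beg]; have [le|lt] := ole_or_olt be al; first by exists be.
exists al; first exact: ole_refl.
suff -> : g = f by [].
by apply: cle_anti (closed_above af fk kf beg) (stage_ole af beg (olt_ole lt)).
Qed.

(** Stages increase, so g comes strictly later than f, and the sequence can only have passed f if F
    is defined there. *)
Lemma reach_total f g : reach F f -> reach F g -> ~ cle g f ->
  exists2 k, F f k & cle (cmax f k) g.
Proof.
move=> [b bf] [c cg] gf; have [cb|bc] := ole_or_olt c b.
  by case: gf; apply: stage_ole cb.
have [k fk] : exists k, F f k.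
  elim: cg bc {gf} => {c g} [c c0|c c' g h cc' c'g IH gh|c s g _ Hs _ Hg _] bc.
  - by case: (ole_oltF (ole_trans c0.1 (ozero_le b)) bc).
  - have /ole_eqVlt[e|] : ole b c' by apply/olt_osucc; apply: oeq_lt bc.
      by exists h; rewrite (stage_fun Ff bf c'g e).
    exact: IH.
  - by rewrite (stage_fun Ff bf (Hs _ bc) (oeq_refl _)); apply: Hg.
by exists k => //; apply: stage_lt bc.
Qed.

(* A stage is determined by any number that enters immediately after it; at
   most one stage, the last one, has no such number. *)
Lemma reach_enum : exists s : nat -> cantor,
  (forall n, reach F (s n)) /\ forall g, reach F g -> exists n, s n = g.
Proof.
pose P n g := if n is m.+1 then exists k, [/\ F g k, k m & ~ g m]
              else forall h, reach F h -> cle h g.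
have P_le n g h : reach F g -> reach F h -> P n g -> P n h -> cle h g.
  case: n => [|n] gr hr; first by move=> + _; apply.
  move=> [k [gk kn gn]] [l [hl ln hn]]; apply: contrapT => hg.
  have [k' gk' kh] := reach_total gr hr hg; rewrite -(Ff gk gk') in kh.
  by apply: hn; move/cleP: kh; apply; rewrite /cmax kn orbT.
have /choice[s Hs] n : exists g, reach F g /\ forall h, reach F h -> P n h -> h = g.
  have [[g [gr gP]]|nP] := pselect (exists g, reach F g /\ P n g).
    exists g; split=> // h hr hP.
    by apply: cle_anti; [exact: (P_le n g h)|exact: (P_le n h g)].
  (* If n marks no stage, the default is the constant 0, itself a stage, so that every [s n] is
     reachable. *)
  exists (fun=> false); split; first exact: reach0.
  by move=> h hr hP; case: nP; exists h.
exists s; split=> [n|g gr]; first by have [] := Hs n.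
suff [n gP] : exists n, P n g by exists n; rewrite ((Hs n).2 g gr gP).
have [gP|/existsNP[h /not_implyP[hr hg]]] := pselect (P 0 g); first by exists 0.
have [k gk kh] := reach_total gr hr hg.
have /existsNP[n /not_implyP[kn gn]] : ~ forall n, k n -> g n.
  move=> /cleP kg; apply: hg; have [b bg] := gr; have [c ch] := hr.
  exact: closed_above bg gk kg ch.
by exists n.+1, k.
Qed.

Hypothesis F_reach : forall g, reach F g -> exists k, F g k.

Lemma stage_ex b : exists f, stage F b f.
Proof.
elim/(well_founded_ind olt_wf): b => b IH.
have [b0|b0] := pselect (oeq b ozero); first by eexists; apply: stage_zero b0.
have [[c bc]|bS] := pselect (exists c, oeq b (osucc c)).
  have [|f cf] := IH c; first by apply: oeq_lt (oeq_sym bc) (olt_succ c).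
  have [|k fk] := F_reach (g := f); first by exists c.
  by exists (cmax f k); apply: stage_succ bc cf fk.
have /choice[s Hs] : forall c, exists f, olt c b -> stage F c f.
  move=> c; have [/IH[f cf]|nc] := pselect (olt c b); first by exists f.
  by exists (fun=> false).
exists (fun n => `[< exists2 c, olt c b & s c n >]).
apply: (stage_limit _ Hs) => [//|c /Hs cs|n]; first by apply: F_reach; exists c.
by split=> [/asboolP|H]; last apply/asboolP.
Qed.

(* Otherwise each ordinal x would have a number n entering at stage x, and the
   rank of n in the order of entry would be at least x. *)
Lemma closed_stage_ex : exists b f k, [/\ stage F b f, F f k & cle k f].
Proof.
apply: contrapT => nclosed.
pose prec n m := exists b f, [/\ stage F b f, f n & ~ f m].
have acc_stage b f n : stage F b f -> f n -> Acc prec n.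
  elim/(well_founded_ind olt_wf): b f n => b IH f n bf fn.
  constructor=> m [c [g [cg gm gn]]].
  have [bc|cb] := ole_or_olt b c; last exact: IH cb _ _ cg gm.
  by case: gn; move/cleP: (stage_ole bf cg bc); apply.
have wf : well_founded prec.
  by move=> m; constructor=> n [b [f [bf fn _]]]; apply: acc_stage bf fn.
have entry x : exists f k n, [/\ stage F x f, F f k, k n & ~ f n].
  have [f xf] := stage_ex x; have [k fk] : exists k, F f k by apply: F_reach; exists x.
  have /existsNP[n kfn] : ~ forall n, k n -> f n.
    by move=> /cleP kf; apply: nclosed; exists x, f, k.
  by exists f, k, n; move/not_implyP: kfn => [].
have rank x f k n : stage F x f -> F f k -> k n -> ~ f n ->
    forall H : Acc prec n, ole x (acc_rank H).
  elim: x f k n => A y IH f k n xf fk kn fn [h] /= i.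
  have [g [l [m [yg gl lm gm]]]] := entry (y i).
  have mn : prec m n.
    exists (osucc (y i)), (cmax g l); split; first exact: stage_osucc.
    - by rewrite /cmax lm orbT.
    - have lt : olt (y i) (Sup y) by exists i; apply: ole_refl.
      by move=> gln; apply: fn; move/cleP: (stage_lt yg gl xf lt); apply.
  by exists (exist _ m mn); apply: IH yg gl lm gm _.
(* A number entering at the strict supremum of all ranks would have a rank not below that
   supremum. *)
have [f [k [n [xf fk kn fn]]]] := entry (Sup (fun n => acc_rank (wf n))).
apply: (@olt_irrefl (Sup (fun n => acc_rank (wf n)))); exists n.
exact: rank xf fk kn fn _.
Qed.

(** At the least closed ordinal the sequence becomes stationary; each earlier stage is properly
    enlarged, which is the positive minimality clause of [ind_val]. *)
Lemma ind_intro : exists g k, [/\ ind_val F g, reach F g, F g k & cle k g].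
Proof.
have [b0 closed0] := closed_stage_ex.
have [b [[f [k [bf fk kf]]] bmin]] : exists b,
    (exists f k, [/\ stage F b f, F f k & cle k f]) /\
    forall c, olt c b -> ~ exists f k, [/\ stage F c f, F f k & cle k f].
  apply: contrapT => nmin; suff : forall b,
    ~ exists f k, [/\ stage F b f, F f k & cle k f] by apply; apply: closed0.
  by elim/(well_founded_ind olt_wf) => b IH bcl; apply: nmin; exists b.
exists f, k; split=> //; last by exists b.
exists b; split=> // [|c cb].
  by move: (stage_osucc bf fk); rewrite (cmax_idP f k).2.
have [g cg] := stage_ex c; have [l gl] : exists k, F g k by apply: F_reach; exists c.
exists g, (cmax g l); split=> //; first exact: stage_osucc.
by move=> /esym/cmax_idP lg; apply: (bmin c) => //; exists g, l.
Qed.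

End Stages.

(** * Norms *)

(** The bound is required for every accessibility proof because [acc_rank] is computed from the
    proof. *)
Definition ctbl (x : ord) : Prop :=
  exists (R : nat -> nat -> Prop) (n : nat),
    well_founded R /\ forall H : Acc R n, ole x (acc_rank H).

Lemma ctbl_lt x : ctbl x -> olt x aleph1.
Proof. by move=> [R [n [wf xn]]]; exists (exist _ R wf); apply: olt_ole; exists n. Qed.

Lemma acc_rank_le (T U : Type) (R : T -> T -> Prop) (S : U -> U -> Prop)
    (h : T -> U) : (forall x y, R x y -> S (h x) (h y)) ->
  forall x (Hx : Acc R x) (Hhx : Acc S (h x)), ole (acc_rank Hx) (acc_rank Hhx).
Proof.
move=> RS x Hx; have ax := Hx; move: Hx.
elim: ax => {}x _ IH [rx] [sx] /= [y yx] /=.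
by exists (exist _ (h y) (RS _ _ yx)); apply: IH.
Qed.

(** The relations [R n] are placed side by side on the disjoint copies [p n k], with a new point 0
    above every [p n (top n)]; the successor in [p] keeps 0 free. *)
Lemma ctbl_Sup (x : nat -> ord) : (forall n, ctbl (x n)) -> ctbl (Sup x).
Proof.
move=> /choice[R] /choice[top Rtop].
have wf n : well_founded (R n) := (Rtop n).1; have Htop n := (Rtop n).2.
pose p n k := (Cantor.to_nat (n, k)).+1.
have p_inj n k m l : p n k = p m l -> n = m /\ k = l.
  by move=> /succn_inj/Cantor.to_nat_inj[-> ->].
pose S i j := (exists n, i = p n (top n) /\ j = 0) \/
  exists n k l, [/\ i = p n k, j = p n l & R n k l].
have SR n k : Acc S (p n k).
  elim/(well_founded_ind (wf n)): k => k IH; constructor=> i.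
  case=> [[? []]//|[m [l [k' [-> /p_inj[<- <-]]]]]]; exact: IH.
have wfS : well_founded S.
  move=> i; constructor=> j; case=> [[n [-> _]]|[n [k [l [-> _ _]]]]]; exact: SR.
exists S, 0; split=> // -[h] /= n.
have Sn : S (p n (top n)) 0 by left; exists n.
exists (exist (fun y => S y 0) _ Sn) => /=; apply: ole_trans (Htop n (wf n (top n))) _.
by apply: (@acc_rank_le _ _ _ _ (p n)) => k l kl; right; exists n, k, l.
Qed.

Lemma ctbl_le x y : ole x y -> ctbl y -> ctbl x.
Proof.
by move=> xy [R [n [wf yn]]]; exists R, n; split=> // H; apply: ole_trans (yn H).
Qed.

Lemma ctbl0 : ctbl ozero.
Proof.
have wf : well_founded (fun _ _ : nat => False) by [].
by exists (fun _ _ => False), 0; split=> // H; apply: ozero_le.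
Qed.

Lemma ctbl_succ x : ctbl x -> ctbl (osucc x).
Proof.
by move=> cx; apply: ctbl_le (ctbl_Sup (fun=> cx)) => i; exists 0; apply: ole_refl.
Qed.

Lemma ctbl_max x y : ctbl x -> ctbl y -> ctbl (omax x y).
Proof.
move=> cx cy; have [xy|/olt_ole yx] := ole_or_olt x y.
  by apply: ctbl_le cy; apply/ole_omax; split=> //; apply: ole_refl.
by apply: ctbl_le cx; apply/ole_omax; split=> //; apply: ole_refl.
Qed.

Lemma fpart_kleene_fun d F f a u g h :
  fpart (fun h y => kleene d F (h :: f) a y) u g ->
  fpart (fun h y => kleene d F (h :: f) a y) u h -> g = h.
Proof. by apply: fpart_fun => v y z; apply: kleene_fun. Qed.

(** Only S8.3 takes a supremum that is not visibly countable; [reach_enum] replaces its stages by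
    numbers. *)
Lemma norm_rel_ctbl t x : norm_rel t x -> ctbl x.
Proof.
elim=> {t x}; try by move=> *; exact: ctbl0.
- by move=> e1 e2 F f a c x y _ _ cx _ cy; apply/ctbl_succ/ctbl_max.
- by move=> *; apply: ctbl_succ.
- by move=> d F1 F f a x _; apply: ctbl_Sup.
- move=> d F f b a al x FG [[u [v [alu uv vu]]] _] _ cx.
  have FGf := @fpart_kleene_fun d F f a.
  have [s [sr s_onto]] := reach_enum FGf.
  pose y i := x (s (Cantor.of_nat i).1) (Cantor.of_nat i).2.
  apply: ctbl_le (_ : ctbl (Sup y)).
    move=> [[g [be beal beg]] n] /=; have [|k <-] := s_onto g; first by exists be.
    exists (Cantor.to_nat (k, n)).
    by rewrite /y Cantor.cancel_of_to; apply: ole_refl.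
  apply: ctbl_Sup => i.
  have [be beal bes] := reach_closed FGf alu uv vu (sr (Cantor.of_nat i).1).
  exact: cx beal bes.
- by move=> *; apply: ctbl_succ.
Qed.

Lemma norm_CI t : in_CI t -> norm_rel t (norm t).
Proof. by rewrite /norm; case: cid => x [/= H _] /H. Qed.

Lemma norm_nCI t : ~ in_CI t -> norm t = aleph1.
Proof. by rewrite /norm; case: cid => x [/= _ H] /H. Qed.

Lemma norm_lt_aleph1 t : in_CI t <-> olt (norm t) aleph1.
Proof.
split=> [/norm_CI/norm_rel_ctbl/ctbl_lt //|tlt].
by apply: contrapT => /norm_nCI E; rewrite E in tlt; apply: olt_irrefl tlt.
Qed.

Lemma norm_le_aleph1 t : ole (norm t) aleph1.
Proof.
have [/norm_lt_aleph1/olt_ole //|/norm_nCI->] := pselect (in_CI t).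
exact: ole_refl.
Qed.

Lemma norm_lt_CI t u : olt (norm t) (norm u) -> in_CI t.
Proof.
by move=> tu; apply/norm_lt_aleph1; apply: olt_ole_trans tu (norm_le_aleph1 u).
Qed.

Lemma norm_le_CI t u : in_CI t \/ in_CI u -> ole (norm t) (norm u) -> in_CI t.
Proof.
move=> [//|/norm_lt_aleph1 ult] tu.
by apply/norm_lt_aleph1; apply: ole_olt_trans ult.
Qed.

Lemma norm_oeq t x : in_CI t -> norm_rel t x -> oeq (norm t) x.
Proof. by move=> /norm_CI; apply: norm_rel_fun. Qed.

Lemma oeq_lt_iff x y z : oeq x y -> olt x z <-> olt y z.
Proof. by move=> [xy yx]; split; apply: ole_olt_trans. Qed.

(** Extends a criterion known for t in C_I. If only u is in C_I, the norm of t is [aleph1] and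
    exceeds that of u, while [C] fails because it would put t in C_I. *)
Lemma norm_le_iff t u (C : Prop) : (in_CI t -> (ole (norm t) (norm u) <-> C)) ->
  (C -> in_CI t) -> in_CI t \/ in_CI u -> (ole (norm t) (norm u) <-> C).
Proof.
move=> tC Ct tu; split=> [le|c].
  by apply/tC => //; apply: norm_le_CI le.
by apply/tC => //; apply: Ct.
Qed.

Section NormLe.

Variables (F : seq fnl) (f : seq fcn) (a : seq nat).

(** The norm is a supremum of successors, so a bound on it is a strict bound on the immediate
    subcomputations. The one of [e1] is available only through the value b of [e2]. *)
Lemma norm_le4 e1 e2 z : in_CI (Tup (code [:: 4; e1; e2]) F f a) ->
  ole (norm (Tup (code [:: 4; e1; e2]) F f a)) z <->
  olt (norm (Tup e2 F f a)) z /\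
  forall b, kleene e2 F f a b -> olt (norm (Tup e1 F f (b :: a))) z.
Proof.
move=> tC; have [c /kleene_inv[b e2b e1c]] := tC.
have [b' [x [y [e2b' nx ny E]]]] := norm_rel_inv (norm_CI tC).
have bb' := kleene_fun e2b e2b'; subst b'.
have x1 : oeq (norm (Tup e2 F f a)) x by apply: norm_oeq nx; exists b.
have y1 : oeq (norm (Tup e1 F f (b :: a))) y by apply: norm_oeq ny; exists c.
rewrite E ole_succ olt_omax -(oeq_lt_iff _ x1) -(oeq_lt_iff _ y1).
split=> [[xz yz]|[xz /(_ b e2b) yz //]].
by split=> // b' /(kleene_fun e2b) <-.
Qed.

Lemma norm_le6 e p1 p2 p3 z :
  in_CI (Tup (code [:: 6; e; code p1; code p2; code p3]) F f a) ->
  ole (norm (Tup (code [:: 6; e; code p1; code p2; code p3]) F f a)) z <->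
  olt (norm (Tup e (permute p1 F) (permute p2 f) (permute p3 a))) z.
Proof.
move=> tC; have [c] := tC => /kleene_inv[q1 [q2 [q3 [[]]]]].
move=> /code_inj<- /code_inj<- /code_inj<- [_ _ _ ec].
have := norm_rel_inv (norm_CI tC) => -[q1' [q2' [q3' [x [[]]]]]].
move=> /code_inj<- /code_inj<- /code_inj<- [_ _ _ nx E].
rewrite E ole_succ (@oeq_lt_iff _ x) //; apply: norm_oeq nx; by exists c.
Qed.

Lemma norm_le82 d F1 z :
  in_CI (Tup (code [:: 8; 2; d]) (F1 :: F) f a) ->
  ole (norm (Tup (code [:: 8; 2; d]) (F1 :: F) f a)) z <->
  forall b, olt (norm (Tup d (F1 :: F) f (b :: a))) z.
Proof.
move=> tC; have [c] := tC => /kleene_inv[_ [_ [g [_ dg _]]]].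
have [x [nx E]] := norm_rel_inv (norm_CI tC); rewrite E ole_Sup.
have dx b : oeq (norm (Tup d (F1 :: F) f (b :: a))) (x b).
  by apply: norm_oeq (nx b); exists (g b); apply: dg.
by split=> H b; [rewrite (oeq_lt_iff _ (dx b))|rewrite -(oeq_lt_iff _ (dx b))].
Qed.

Lemma norm_le9 d z :
  in_CI (Tup (code [:: 9]) F f (d :: a)) ->
  ole (norm (Tup (code [:: 9]) F f (d :: a))) z <-> olt (norm (Tup d F f a)) z.
Proof.
move=> tC; have [c] := tC => /kleene_inv[_ [_ [[<- <-] dc]]].
have [_ [_ [x [[<- <-] nx E]]]] := norm_rel_inv (norm_CI tC).
rewrite E ole_succ (@oeq_lt_iff _ x) //; apply: norm_oeq nx; by exists c.
Qed.

Definition FG d := fpart (fun h y => kleene d F (h :: f) a y).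

(** From right to left, an operator defined at all its stages closes by Hartogs' argument;
    conversely, no new stage occurs after closure. *)
Lemma in_CI83 d b : in_CI (Tup (code [:: 8; 3; d]) F f (b :: a)) <->
  forall g n, reach (FG d) g -> in_CI (Tup d F (cprepend n g :: f) a).
Proof.
have FGf : forall f g h, FG d f g -> FG d f h -> g = h by apply: fpart_kleene_fun.
split=> [[c /kleene_inv[_ [_ [g [[_ <-] dg _]]]]]|H].
  have [al [[[u [v [alu uv vu]]] _] Hal]] := ind_val_closure (fun _ _ => id) FGf dg.
  move=> h n hr; have [be beal beh] := reach_closed FGf alu uv vu hr.
  by have [k /(_ n)[y [hy _]]] := Hal _ _ beal beh; exists y.
have [g hr|g [k [dg _ _ _]]] := ind_intro FGf _.
  have /choice[y Hy] n : exists y, kleene d F (cprepend n g :: f) a y.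
    exact: (H g n hr).
  exists (fun n => minn (y n) 1 == 1) => n; exists (y n); split=> //.
  by case: (y n) => // m; rewrite minnSS minn0.
by exists (g b); apply: KS83.
Qed.

Lemma norm_le83 d b z :
  in_CI (Tup (code [:: 8; 3; d]) F f (b :: a)) ->
  ole (norm (Tup (code [:: 8; 3; d]) F f (b :: a))) z <->
  forall g n, reach (FG d) g -> olt (norm (Tup d F (cprepend n g :: f) a)) z.
Proof.
move=> tC; have [_ [_ [al [x [[_ <-] [[u [v [alu uv vu]]] _] nx E]]]]] :=
  norm_rel_inv (norm_CI tC).
have FGf : forall f g h, FG d f g -> FG d f h -> g = h by apply: fpart_kleene_fun.
have x1 g n be : ole be al -> stage (FG d) be g ->
    oeq (norm (Tup d F (cprepend n g :: f) a)) (x g n).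
  move=> beal beg; apply: norm_oeq (nx be g n beal beg).
  by apply: (in_CI83 d b).1 => //; exists be.
rewrite E ole_Sup; split=> [H g n gr|H [[g [be beal beg]] n] /=].
  have [be beal beg] := reach_closed FGf alu uv vu gr.
  rewrite (oeq_lt_iff _ (x1 _ n _ beal beg)).
  by apply: (H (exist _ g _, n)); exists be.
by rewrite -(oeq_lt_iff _ (x1 _ n _ beal beg)); apply: H; exists be.
Qed.

End NormLe.

(** * Permutations *)

(* Reversal of an initial segment brings the entry i to the front, and is an
   involution. *)
Definition front i := rev (iota 0 i.+1).

Lemma permute_nil (T : Type) (s : seq T) : permute [::] s = s.
Proof. by rewrite /permute /= drop0. Qed.

Lemma perm_for_nil (T : Type) (s : seq T) : perm_for [::] s.
Proof. by []. Qed.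

Lemma size_front i : size (front i) = i.+1.
Proof. by rewrite size_rev size_iota. Qed.

Lemma perm_for_front (T : Type) (s : seq T) i : i < size s -> perm_for (front i) s.
Proof. by move=> si; rewrite /perm_for size_front si andbT perm_rev. Qed.

Lemma permute_front (T : Type) (s : seq T) i : i < size s ->
  permute (front i) s = rev (take i.+1 s) ++ drop i.+1 s.
Proof.
move=> si; rewrite /permute size_front; congr (_ ++ _).
have E k : k <= size s -> pmap (onth s) (rev (iota 0 k)) = rev (take k s).
  elim: k => [|k IH] ks; first by rewrite take0.
  case: s ks {si} IH => // x s ks IH.
  rewrite -addn1 iotaD rev_cat /= add0n addn1 (take_nth x ks) rev_rcons.
  by rewrite IH ?(ltnW ks) // -[k]addn0 (onthE (x :: s)) (nth_map x) ?addn0.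
exact: E.
Qed.

Lemma permute_front_nth (T : Type) (x : T) (s : seq T) i : i < size s ->
  exists s', permute (front i) s = nth x s i :: s'.
Proof.
by move=> si; rewrite permute_front // (take_nth x si) rev_rcons; eexists.
Qed.

Lemma size_permute_front (T : Type) (s : seq T) i : i < size s ->
  size (permute (front i) s) = size s.
Proof.
by move=> si; rewrite permute_front // size_cat size_rev -size_cat cat_take_drop.
Qed.

Lemma permute_frontK (T : Type) (s : seq T) i : i < size s ->
  permute (front i) (permute (front i) s) = s.
Proof.
move=> si; rewrite permute_front ?size_permute_front // permute_front //.
have st : size (rev (take i.+1 s)) = i.+1 by rewrite size_rev size_takel.
by rewrite take_size_cat // drop_size_cat // revK cat_take_drop.
Qed.

(** * Indices *)

Definition proj i := code [:: 6; code [:: 3]; code [::]; code [::]; code (front i)].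

Lemma kleene_proj F f a i : i < size a -> kleene (proj i) F f a (nth 0 a i).
Proof.
move=> ai; apply: KS6; rewrite ?perm_for_nil ?perm_for_front //.
have [s ->] := permute_front_nth 0 ai; exact: KS3.
Qed.

(* The induction with the constant operator n |-> min(b, 1). *)
Lemma kleene_sg_ex : exists e, forall F f b a, kleene e F f (b :: a) (b != 0).
Proof.
exists (code [:: 4; code [:: 8; 3; code [:: 3]]; code [:: 2; 0]]) => F f b a.
apply: KS4 (KS2 _ _ _ _) _.
have Fc u k : FG F f (b :: a) (code [:: 3]) u k <-> k = fun=> b != 0.
  split=> [uk|-> n]; last first.
    by exists b; split; [exact: KS3|case: b => [|b]; rewrite // minnSS minn0].
  apply/funext=> n; have [y [/kleene_inv[_ [_ [[<- _] ->]]]]] := uk n.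
  by case: b {uk} => [|b]; rewrite ?minnSS ?minn0; case: (k n).
have FGf := @fpart_kleene_fun (code [:: 3]) F f (b :: a).
have [u _|g [k [Hg gr /Fc -> kg]]] := ind_intro FGf _.
  by exists (fun=> b != 0); apply/Fc.
have gb n : g n -> b != 0.
  elim/reach_ind: gr n => {g Hg k kg} // [g k _ IH /Fc -> n /orP[/IH|]|X g IX gX n] //.
  by move=> /gX[h /IX[_ +]]; apply.
have -> : (b != 0) = g 0.
  by apply/idP/idP => [b0|/gb //]; move: (kg 0); rewrite b0; case: (g 0).
exact: KS83.
Qed.

Definition sg_i := sval (cid kleene_sg_ex).
Definition kleene_sg := svalP (cid kleene_sg_ex).

Fixpoint addk_i k :=
  if k is k'.+1 then code [:: 4; code [:: 1]; addk_i k'] else code [:: 3].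

Lemma kleene_addk k F f b a : kleene (addk_i k) F f (b :: a) (b + k).
Proof.
elim: k => [|k IH]; first by rewrite addn0; apply: KS3.
by rewrite addnS; apply: KS4 IH _; apply: KS1.
Qed.

(* Definition by cases, from the consecutive indices <3> and <2,0>. *)
Lemma kleene_case_ex q : exists e, forall F f (b : bool) a,
  kleene e F f (nat_of_bool b :: a) (if b then 0 else q).
Proof.
exists (code [:: 4; code [:: 4; code [:: 9]; code [:: 4; addk_i (code [:: 3]); proj 1]];
             code [:: 2; q]]) => F f b a.
apply: KS4 (KS2 _ _ _ _) _.
apply: (@KS4 _ _ _ _ _ (b + code [:: 3])).
  by apply: KS4 (kleene_proj _ _ _) _ => //; apply: kleene_addk.
apply: KS9; case: b; last exact: KS3.
by have -> : 1 + code [:: 3] = code [:: 2; 0] by []; apply: KS2.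
Qed.

(** The smaller of i and j is added to a choice between 0 and their difference; if j is the smaller,
    the test is negated. *)
Lemma kleene_choose_ex i j : exists e, forall F f b a,
  kleene e F f (b :: a) (if b == 0 then j else i).
Proof.
have [e He] := kleene_case_ex (if i <= j then j - i else i - j).
have [e1 He1] := kleene_case_ex 1.
case: ifPn He => [ij|]; [|rewrite -ltnNge => /ltnW ji] => He.
  exists (code [:: 4; addk_i i; code [:: 4; e; sg_i]]) => F f b a.
  apply: KS4; first by apply: KS4 (kleene_sg _ _ _ _) (He _ _ _ _).
  have := kleene_addk i F f; case: (b == 0) => /=; last exact.
  by move=> /(_ (j - i)); rewrite subnK.
exists (code [:: 4; addk_i j; code [:: 4; e; code [:: 4; e1; sg_i]]]) => F f b a.
apply: KS4.
  apply: KS4 (He _ _ (b == 0) _).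
  apply: KS4 (kleene_sg _ _ _ _) _.
  by have := He1 F f (b != 0) (b :: a); case: (b == 0); apply.
have := kleene_addk j F f; case: (b == 0) => /=; first exact.
by move=> /(_ (i - j)); rewrite subnK.
Qed.

Definition choose_i i j := sval (cid (kleene_choose_ex i j)).
Definition kleene_choose i j := svalP (cid (kleene_choose_ex i j)).

(** * A programming language *)

Inductive prog :=
| Var of nat
| Cst of nat
| Let of prog & prog
| Arg of prog & prog
| Go of nat
| GoDyn of prog
| If of prog & prog & prog
| Ind of prog & prog.

Definition mcons (m : nat -> nat) i := if i is i'.+1 then (m i').+1 else 0.

(* [m] gives the positions of the variables in the list of numbers. [Arg]
   pushes an argument for a later jump [Go] or [GoDyn], the argument not
   being visible as a variable. *)
Fixpoint compile (m : nat -> nat) (p : prog) : nat :=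
  match p with
  | Var i => proj (m i)
  | Cst n => code [:: 2; n]
  | Let p q => code [:: 4; compile (mcons m) q; compile m p]
  | Arg p q => code [:: 4; compile (S \o m) q; compile m p]
  | Go e => e
  | GoDyn p => code [:: 4; code [:: 9]; compile m p]
  | If p q r => code [:: 4; code [:: 9];
                  code [:: 4; choose_i (compile m q) (compile m r); compile m p]]
  | Ind p q => code [:: 4; code [:: 8; 3; compile m q]; compile m p]
  end.

Definition env_ok (m : nat -> nat) (r a : seq nat) :=
  forall i, i < size r -> m i < size a /\ nth 0 a (m i) = nth 0 r i.

Lemma env_ok_push m r a x : env_ok m r a -> env_ok (S \o m) r (x :: a).
Proof. by move=> H i /H[]. Qed.

Lemma env_ok_cons m r a x : env_ok m r a -> env_ok (mcons m) (x :: r) (x :: a).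
Proof. by move=> H [|i] //= /H[]. Qed.

Lemma env_ok_cat r a : env_ok id r (r ++ a).
Proof. by move=> i ir; rewrite size_cat ltn_addr // nth_cat ir. Qed.

(** The numbers [s] are the arguments already pushed for a pending jump; the variables lie behind
    them. *)
Definition evs F f r s p c :=
  forall m a, env_ok m r (s ++ a) -> kleene (compile m p) F f (s ++ a) c.

Definition ev F f r p c := forall m a, env_ok m r a -> kleene (compile m p) F f a c.

Section Ev.

Variables (F : seq fnl) (f : seq fcn) (r : seq nat).

Lemma evs0 p c : evs F f r [::] p c -> ev F f r p c.
Proof. by move=> H m a; apply: H. Qed.

Lemma ev_var i : i < size r -> ev F f r (Var i) (nth 0 r i).
Proof. by move=> ir m a /(_ i ir)[ma <-]; apply: kleene_proj. Qed.

Lemma ev_cst n : ev F f r (Cst n) n.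
Proof. by move=> m a _; apply: KS2. Qed.

Lemma ev_let p q b c : ev F f r p b -> ev F f (b :: r) q c -> ev F f r (Let p q) c.
Proof.
by move=> Hp Hq m a ma; apply: KS4 (Hp m a ma) _; apply: Hq; apply: env_ok_cons.
Qed.

Lemma evs_arg s p q b c :
  ev F f r p b -> evs F f r (b :: s) q c -> evs F f r s (Arg p q) c.
Proof.
by move=> Hp Hq m a ma; apply: KS4 (Hp m _ ma) _; apply: (Hq _ a); apply: env_ok_push.
Qed.

Lemma evs_go s e c : (forall a, kleene e F f (s ++ a) c) -> evs F f r s (Go e) c.
Proof. by move=> H m a _; apply: H. Qed.

Lemma evs_godyn s p e c :
  ev F f r p e -> (forall a, kleene e F f (s ++ a) c) -> evs F f r s (GoDyn p) c.
Proof. by move=> Hp He m a ma; apply: KS4 (Hp m _ ma) _; apply: KS9. Qed.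

(** The test selects the index of a branch and S9 runs only that index, so the other branch may be
    undefined. *)
Lemma ev_if p q q' b c :
  ev F f r p b -> (b <> 0 -> ev F f r q c) -> (b = 0 -> ev F f r q' c) ->
  ev F f r (If p q q') c.
Proof.
move=> Hp Hq Hq' m a ma; rewrite /=.
apply: KS4; first by apply: KS4 (Hp m a ma) _; apply: kleene_choose.
by apply: KS9; case: eqP => [/Hq'|/Hq]; apply.
Qed.

Lemma ev_ind p q b g :
  ev F f r p b -> ind_val (fpart (fun h y => ev F (h :: f) r q y)) g ->
  ev F f r (Ind p q) (g b).
Proof.
move=> Hp Hq m a ma; apply: KS4 (Hp m a ma) _; apply: KS83.
apply: ind_val_mono Hq => u v uv n; have [y [Hy vy]] := uv n.
by exists y; split=> //; apply: Hy.
Qed.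

Lemma ev_eq p c d : ev F f r p c -> c = d -> ev F f r p d.
Proof. by move=> H <-. Qed.

Lemma ev_fun p c d : ev F f r p c -> ev F f r p d -> c = d.
Proof.
have ok : env_ok id r r by rewrite -[X in env_ok _ _ X]cats0; apply: env_ok_cat.
by move=> /(_ id r ok) H /(_ id r ok); apply: kleene_fun.
Qed.

Lemma ev_kleene p c a : ev F f r p c -> kleene (compile id p) F f (r ++ a) c.
Proof. by apply; apply: env_ok_cat. Qed.

End Ev.

(** The generated set need not be described: it suffices that c follows from g being a reachable
    stage closed under q. Termination of q at the reachable stages guarantees such a g. *)
Lemma ev_ind_reach F f r p q b c :
  let R := fpart (fun h y => ev F (h :: f) r q y) in
  ev F f r p b ->
  (forall g n, reach R g -> exists y, ev F (cprepend n g :: f) r q y) ->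
  (forall g, reach R g ->
     (forall n y, ev F (cprepend n g :: f) r q y -> y != 0 -> g n) ->
     nat_of_bool (g b) = c) ->
  ev F f r (Ind p q) c.
Proof.
move=> R Hp HR Hc; have Rf : forall f g h, R f g -> R f h -> g = h.
  by apply: fpart_fun => u y z; apply: ev_fun.
have [g gr|g [k [Hg gr gk kg]]] := ind_intro Rf _.
  have /choice[y Hy] n := HR g n gr.
  exists (fun n => minn (y n) 1 == 1) => n; exists (y n); split=> //.
  by case: (y n) => // m; rewrite minnSS minn0.
rewrite -(Hc g gr); first exact: ev_ind Hp Hg.
move=> n y Hy y0; have [y' [Hy' kn]] := gk n; rewrite -(ev_fun Hy Hy') in kn.
move: (kg n) kn; case: (k n) (g n) y0 => -[] //.
by case: y {Hy} => // y; rewrite minnSS minn0.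
Qed.

Lemma ev_ind_total F f r p q b c (phi : cantor -> nat -> nat) :
  ev F f r p b ->
  (forall u n, ev F (cprepend n u :: f) r q (phi u n)) ->
  (forall g, reach (fun u v => v = fun n => phi u n != 0) g ->
     (forall n, phi g n != 0 -> g n) -> nat_of_bool (g b) = c) ->
  ev F f r (Ind p q) c.
Proof.
move=> Hp Hq Hc; apply: ev_ind_reach Hp _ _ => [g n _|g gr gq].
  by exists (phi g n).
apply: Hc => [|n]; last exact: gq.
suff <- : fpart (fun h y => ev F (h :: f) r q y) = fun u v => v = fun n => phi u n != 0.
  by [].
apply/funext=> u; apply/funext=> v; apply/propext; split=> [uv|-> n].
  apply/funext=> n; have [y [Hy vn]] := uv n; move: vn; rewrite -(ev_fun (Hq u n) Hy).
  by case: (phi u n) => [|m]; rewrite ?minnSS ?minn0; case: (v n).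
by exists (phi u n); split=> //; case: (phi u n) => // m; rewrite minnSS minn0.
Qed.

(** * Computable number-theoretic functions *)

Definition cfun1 (phi : nat -> nat) :=
  {e : nat | forall F f x a, kleene e F f (x :: a) (phi x)}.
Definition cfun2 (phi : nat -> nat -> nat) :=
  {e : nat | forall F f x y a, kleene e F f [:: x, y & a] (phi x y)}.
Definition cfun3 (phi : nat -> nat -> nat -> nat) :=
  {e : nat | forall F f x y z a, kleene e F f [:: x, y, z & a] (phi x y z)}.

Definition A1 phi (e : cfun1 phi) p := Arg p (Go (sval e)).
Definition A2 phi (e : cfun2 phi) p q := Arg q (Arg p (Go (sval e))).
Definition A3 phi (e : cfun3 phi) p q s := Arg s (Arg q (Arg p (Go (sval e)))).

Definition Suc p := Arg p (Go (code [:: 1])).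
Definition Hap p := Arg p (Go (code [:: 7])).

(** The called index is also passed as first argument, so that the callee can call itself again. *)
Definition Call2 z p q := Arg q (Arg p (Arg z (GoDyn z))).
Definition Call3 z p q s := Arg s (Arg q (Arg p (Arg z (GoDyn z)))).

Section EvApp.

Variables (F : seq fnl) (f : seq fcn) (r : seq nat).

Lemma ev_A1 phi (e : cfun1 phi) p x : ev F f r p x -> ev F f r (A1 e p) (phi x).
Proof.
by move=> Hp; apply/evs0/(evs_arg Hp)/evs_go => a; apply: (svalP e).
Qed.

Lemma ev_A2 phi (e : cfun2 phi) p q x y :
  ev F f r p x -> ev F f r q y -> ev F f r (A2 e p q) (phi x y).
Proof.
move=> Hp Hq; apply/evs0/(evs_arg Hq)/(evs_arg Hp)/evs_go => a.
exact: (svalP e).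
Qed.

Lemma ev_A3 phi (e : cfun3 phi) p q s x y z :
  ev F f r p x -> ev F f r q y -> ev F f r s z -> ev F f r (A3 e p q s) (phi x y z).
Proof.
move=> Hp Hq Hs; apply/evs0/(evs_arg Hs)/(evs_arg Hq)/(evs_arg Hp)/evs_go => a.
exact: (svalP e).
Qed.

Lemma ev_suc p x : ev F f r p x -> ev F f r (Suc p) x.+1.
Proof. by move=> Hp; apply/evs0/(evs_arg Hp)/evs_go => a; apply: KS1. Qed.

Lemma ev_hap h p x : ev F (h :: f) r p x -> ev F (h :: f) r (Hap p) (h x).
Proof. by move=> Hp; apply/evs0/(evs_arg Hp)/evs_go => a; apply: KS7. Qed.

Lemma ev_call2 z p q e x y c : ev F f r z e -> ev F f r p x -> ev F f r q y ->
  (forall a, kleene e F f [:: e, x, y & a] c) -> ev F f r (Call2 z p q) c.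
Proof.
by move=> Hz Hp Hq H; apply/evs0/(evs_arg Hq)/(evs_arg Hp)/(evs_arg Hz)/(evs_godyn Hz).
Qed.

Lemma ev_call3 z p q s e x y w c :
  ev F f r z e -> ev F f r p x -> ev F f r q y -> ev F f r s w ->
  (forall a, kleene e F f [:: e, x, y, w & a] c) -> ev F f r (Call3 z p q s) c.
Proof.
move=> Hz Hp Hq Hs H.
exact/evs0/(evs_arg Hs)/(evs_arg Hq)/(evs_arg Hp)/(evs_arg Hz)/(evs_godyn Hz).
Qed.

End EvApp.

(* The recursion theorem: the program is run with its own index as the
   variable 0. *)
Definition fix_i p := code [:: 4; compile id p; code [:: 2; compile id p]].

Lemma kleene_fix p F f a c :
  kleene (compile id p) F f (compile id p :: a) c -> kleene (fix_i p) F f a c.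
Proof. by move=> H; apply: KS4 (KS2 _ _ _ _) H. Qed.

Ltac evt := repeat first
  [ exact: ev_cst | (apply: ev_var; exact: isT) | apply: ev_A1 | apply: ev_A2
  | apply: ev_A3 | apply: ev_suc | apply: ev_hap | eassumption ].
Ltac evq := eapply ev_eq; [evt|rewrite /=].

Lemma mk1 phi p : (forall F f x, ev F f [:: x] p (phi x)) -> cfun1 phi.
Proof. by exists (compile id p) => F f x a; apply: (@ev_kleene _ _ [:: x]). Qed.

Lemma mk2 phi p : (forall F f x y, ev F f [:: x; y] p (phi x y)) -> cfun2 phi.
Proof. by exists (compile id p) => F f x y a; apply: (@ev_kleene _ _ [:: x; y]). Qed.

Lemma mk3 phi p : (forall F f x y z, ev F f [:: x; y; z] p (phi x y z)) -> cfun3 phi.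
Proof. by exists (compile id p) => F f x y z a; apply: (@ev_kleene _ _ [:: x; y; z]). Qed.

(* The set {n | n <= y} is generated upwards from 0, until y is in it. In a
   subcomputation with n prepended to the stage g, [Hap (Hap (Cst 0))] gives
   the value of g at n - 1. *)
Lemma le_c : cfun2 (fun x y => x <= y).
Proof.
apply: (@mk2 _ (Ind (Var 0) (If (Hap (Suc (Var 1))) (Cst 0)
  (If (Hap (Cst 0)) (Hap (Hap (Cst 0))) (Cst 1))))) => F f x y.
apply: (@ev_ind_total _ _ _ _ _ x _
  (fun u n => if u y then 0 else if n is n'.+1 then u n' else 1)).
- exact: ev_var.
- move=> u n; apply: ev_if; first by evt.
    by rewrite /cprepend /=; case: (u y) => // _; apply: ev_cst.
  rewrite /cprepend /=; case: (u y) => // _; case: n => [|n].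
    by apply: ev_if; [evt|by []|move=> _; evt].
  by apply: ev_if; [evt| |by []] => _; evq.
move=> g gr gc; suff [gy gd] : (forall n, g n -> n <= y) /\ (forall n, g n.+1 -> g n).
  (* Were y missing, closure would force 0 and all successors, and hence y, into g. *)
  have gy1 : g y.
    apply: contraT => /negbTE ngy; rewrite ngy in gc.
    suff : g y by rewrite ngy.
    by elim: (y) => [|n IH]; [apply: gc|apply: gc; rewrite IH].
  have gle : forall k, g (y - k).
    elim=> [|k IH]; first by rewrite subn0.
    by rewrite subnS; case: (y - k) IH => //= n /gd.
  congr nat_of_bool; apply/idP/idP => [/gy //|xy].
  by rewrite -(subKn xy).
elim/reach_ind: gr => {g gc} [//|g _ _ [gy gd] ->|X g IX gX].
- rewrite /cmax; case gyE: (g y).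
    by split=> n; rewrite !orbF; [apply: gy|apply: gd].
  split=> [[|n]|n] //=.
    case/orP => [/gy //|]; rewrite eqb0 negbK => gn.
    by move: (gy n gn); rewrite leq_eqVlt; case: eqP gn => // ->; rewrite gyE.
  by case/orP => [/gd->//|]; rewrite eqb0 negbK => ->.
- split=> n /gX[h Xh hn]; have [_ [hy hd]] := IX h Xh; first exact: hy.
  by apply/gX; exists h => //; apply: hd.
Qed.
Lemma pred_c : cfun1 predn.
Proof.
pose p := If (A2 le_c (Var 2) (Suc (Var 1))) (Var 1)
             (Call2 (Var 0) (Suc (Var 1)) (Var 2)).
have Hp F f x k a : k <= x.-1 ->
    kleene (compile id p) F f [:: compile id p, x.-1 - k, x & a] x.-1.
  elim: k a => [|k IH] a kx; apply: (@ev_kleene _ _ [:: _; _; _]).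
    apply: ev_if; [evt|move=> _|].
      by apply: ev_eq; [evt|rewrite /= subn0].
    by move=> /= /eqP; rewrite eqb0; lia.
  apply: ev_if; [evt|rewrite /=|rewrite /= => _].
    by move=> /eqP; rewrite eqb0 negbK; lia.
  apply: ev_call2; [evt|evt|evt|] => b /=; rewrite subnSK; last lia.
  by apply: IH; lia.
exists (code [:: 4; fix_i p; code [:: 2; 0]]) => F f x a.
apply: KS4 (KS2 _ _ _ _) _; apply: kleene_fix.
by have := Hp F f x _ a (leqnn _); rewrite subnn.
Qed.

Fixpoint nrec (b : nat -> nat) (s : nat -> nat -> nat -> nat) n w :=
  if n is k.+1 then s k (nrec b s k w) w else b w.

Lemma nrec_c b s : cfun1 b -> cfun3 s -> cfun2 (nrec b s).
Proof.
move=> bc sc.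
pose p := If (Var 1) (A3 sc (A1 pred_c (Var 1))
  (Call2 (Var 0) (A1 pred_c (Var 1)) (Var 2)) (Var 2)) (A1 bc (Var 2)).
have Hp F f n w a : kleene (compile id p) F f [:: compile id p, n, w & a] (nrec b s n w).
  elim: n a => [|n IH] a; apply: (@ev_kleene _ _ [:: _; _; _]).
    by apply: ev_if; [evt|by []|move=> _; evt].
  apply: ev_if; [evt|move=> _|by []].
  apply: ev_A3; [evq; reflexivity| |evt].
  by apply: ev_call2; [evt|evt|evt|].
by exists (fix_i p) => F f n w a; apply: kleene_fix.
Qed.

Lemma const_c n : cfun1 (fun=> n).
Proof. by apply: (@mk1 _ (Cst n)) => F f x; apply: ev_cst. Qed.

Lemma id_c : cfun1 id.
Proof. by apply: (@mk1 _ (Var 0)) => F f x; evt. Qed.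

Lemma add_c : cfun2 addn.
Proof.
have sc : cfun3 (fun _ v _ => v.+1).
  by apply: (@mk3 _ (Suc (Var 1))) => F f x y z; evt.
apply: (@mk2 _ (A2 (nrec_c id_c sc) (Var 0) (Var 1))) => F f x y.
by evq; elim: x => //= x ->.
Qed.

Lemma sub_c : cfun2 subn.
Proof.
have sc : cfun3 (fun _ v _ => v.-1).
  by apply: (@mk3 _ (A1 pred_c (Var 1))) => F f x y z; evt.
apply: (@mk2 _ (A2 (nrec_c id_c sc) (Var 1) (Var 0))) => F f x y.
by evq; elim: y => [|y /= ->]; rewrite /= ?subn0 // subnS.
Qed.

Lemma eq_c : cfun2 (fun x y => x == y).
Proof.
apply: (@mk2 _ (If (A2 le_c (Var 0) (Var 1)) (A2 le_c (Var 1) (Var 0)) (Cst 0))).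
move=> F f x y; apply: ev_if; [evt| |] => /= /eqP; rewrite eqb0 ?negbK eqn_leq.
  by move=> ->; evt.
by move=> /negbTE->; evt.
Qed.

Lemma or_c : cfun2 (fun x y => (x != 0) || (y != 0)).
Proof.
apply: (@mk2 _ (If (Var 0) (Cst 1) (If (Var 1) (Cst 1) (Cst 0)))) => F f x y.
apply: ev_if; first by evt.
  by move=> /eqP/= ->; evt.
move=> /= ->; apply: ev_if; first by evt.
  by move=> /eqP/= ->; evt.
by move=> /= ->; evt.
Qed.

Lemma and_c : cfun2 (fun x y => (x != 0) && (y != 0)).
Proof.
apply: (@mk2 _ (If (Var 0) (If (Var 1) (Cst 1) (Cst 0)) (Cst 0))) => F f x y.
apply: ev_if; [evt|move=> /eqP/= ->|by move=> /= ->; evt].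
apply: ev_if; first by evt.
  by move=> /eqP/= ->; evt.
by move=> /= ->; evt.
Qed.

(** * Pairing and codes of finite sequences *)

Definition pr x y := Cantor.to_nat (x, y).
Definition p1 z := (Cantor.of_nat z).1.
Definition p2 z := (Cantor.of_nat z).2.

Lemma pr1 x y : p1 (pr x y) = x.
Proof. by rewrite /p1 Cantor.cancel_of_to. Qed.

Lemma pr2 x y : p2 (pr x y) = y.
Proof. by rewrite /p2 Cantor.cancel_of_to. Qed.

Lemma prK z : pr (p1 z) (p2 z) = z.
Proof. by rewrite /pr -surjective_pairing Cantor.cancel_to_of. Qed.

Lemma p2_le z : p2 z <= z.
Proof.
rewrite -{2}[z]prK; apply/leP.
apply: PeanoNat.Nat.le_trans (Cantor.to_nat_non_decreasing _ _).
exact: PeanoNat.Nat.le_add_r.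
Qed.

Lemma pr_c : cfun2 pr.
Proof.
have sc : cfun3 (fun k v _ => k.+1 + v).
  by apply: (@mk3 _ (A2 add_c (Suc (Var 0)) (Var 1))) => F f x y z; evt.
apply: (@mk2 _ (A2 add_c (Var 1)
   (A2 (nrec_c (const_c 0) sc) (A2 add_c (Var 1) (Var 0)) (Cst 0)))) => F f x y.
evq; suff E n : nrec (fun=> 0) (fun k v => fun=> k.+1 + v) n 0 =
    nat_rec _ 0 (fun i m => (S i + m)%coq_nat) n by rewrite E.
by elim: n => //= n ->.
Qed.

(** One step of the enumeration of pairs along the antidiagonals, by which [Cantor.of_nat] recurses;
    unpairing becomes iteration instead of search. *)
Definition unpair_step (z : nat * nat) :=
  if z.1 is x.+1 then (x, z.2.+1) else (z.2.+1, 0).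

Lemma of_natE n : Cantor.of_nat n = iter n unpair_step (0, 0).
Proof.
elim: n => // n IH; rewrite iterS -IH /unpair_step.
rewrite -[LHS]/(let: (x, y) := Cantor.of_nat n in
  if x is x'.+1 then (x', y.+1) else (y.+1, 0)).
by case: (Cantor.of_nat n) => -[].
Qed.

Lemma unpair_c i : i < 2 -> cfun1 (fun z => nth 0 [:: p1 z; p2 z] i).
Proof.
move=> i2.
pose p := If (Var 3) (If (Var 1)
    (Call3 (Var 0) (A1 pred_c (Var 1)) (Suc (Var 2)) (A1 pred_c (Var 3)))
    (Call3 (Var 0) (Suc (Var 2)) (Cst 0) (A1 pred_c (Var 3)))) (Var i.+1).
have Hp F f x y n a :
    kleene (compile id p) F f [:: compile id p, x, y, n & a]
      (let z := iter n unpair_step (x, y) in nth 0 [:: z.1; z.2] i).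
  elim: n x y a => [|n IH] x y a; apply: (@ev_kleene _ _ [:: _; _; _; _]).
    apply: ev_if; [evt|by []|move=> _].
    by case: i i2 @p => [|[]] // _ p; evt.
  apply: ev_if; [evt|move=> _|by []]; rewrite iterSr.
  apply: ev_if; [evt| |] => /=.
    by case: x => // x _; apply: ev_call3; [evt|evt|evt|evt|move=> b; apply: IH].
  by move=> ->; apply: ev_call3; [evt|evt|evt|evt|move=> b; apply: IH].
exists (code [:: 4; code [:: 4; fix_i p; code [:: 2; 0]]; code [:: 2; 0]]) => F f z a.
apply: KS4 (KS2 _ _ _ _) _; apply: KS4 (KS2 _ _ _ _) _; apply: kleene_fix.
by have := Hp F f 0 0 z a; rewrite /= -of_natE.
Qed.

Lemma p1_c : cfun1 p1. Proof. exact: (@unpair_c 0). Qed.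
Lemma p2_c : cfun1 p2. Proof. exact: (@unpair_c 1). Qed.

Lemma code_nil : code [::] = 0. Proof. by []. Qed.

Lemma code_cons x s : code (x :: s) = (pr x (code s)).+1. Proof. by []. Qed.

(** Every number being a code, operations on sequences are total on numbers and no validity has to
    be tested. *)
Lemma code_onto z : exists s, code s = z.
Proof.
elim/ltn_ind: z => -[|z] IH; first by exists [::].
have [|s E] := IH (p2 z); first by rewrite ltnS p2_le.
by exists (p1 z :: s); rewrite code_cons E prK.
Qed.

Definition decode z := sval (cid (code_onto z)).

Lemma decodeK z : code (decode z) = z.
Proof. exact: svalP (cid (code_onto z)). Qed.

Lemma codeK s : decode (code s) = s.
Proof. exact/code_inj/decodeK. Qed.

Definition hdz z := p1 z.-1.
Definition tlz z := p2 z.-1.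
Definition consz x z := (pr x z).+1.

Lemma hdz_code s : hdz (code s) = nth 0 s 0.
Proof. by case: s => [|x s]; rewrite /hdz ?code_nil ?code_cons //= pr1. Qed.

Lemma tlz_code s : tlz (code s) = code (behead s).
Proof. by case: s => [|x s]; rewrite /tlz ?code_nil ?code_cons //= pr2. Qed.

Lemma hdz_c : cfun1 hdz.
Proof. by apply: (@mk1 _ (A1 p1_c (A1 pred_c (Var 0)))) => F f z; evt. Qed.

Lemma tlz_c : cfun1 tlz.
Proof. by apply: (@mk1 _ (A1 p2_c (A1 pred_c (Var 0)))) => F f z; evt. Qed.

Lemma consz_c : cfun2 consz.
Proof. by apply: (@mk2 _ (Suc (A2 pr_c (Var 0) (Var 1)))) => F f x z; evt. Qed.

Definition dropz n z := code (drop n (decode z)).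
Definition nthz z n := nth 0 (decode z) n.

Lemma dropz_c : cfun2 dropz.
Proof.
have sc : cfun3 (fun _ v _ => tlz v).
  by apply: (@mk3 _ (A1 tlz_c (Var 1))) => F f x y z; evt.
apply: (@mk2 _ (A2 (nrec_c id_c sc) (Var 0) (Var 1))) => F f n z.
evq; rewrite /dropz; elim: n => [|n IH]; first by rewrite drop0 decodeK.
by rewrite /= IH tlz_code -drop1 drop_drop.
Qed.

Lemma nthz_c : cfun2 nthz.
Proof.
apply: (@mk2 _ (A1 hdz_c (A2 dropz_c (Var 1) (Var 0)))) => F f z n.
by evq; rewrite /dropz hdz_code nth_drop addn0.
Qed.

Lemma fold_c s b : cfun3 s -> cfun1 b ->
  cfun2 (fun z w => foldr (fun x v => s x v w) (b w) (decode z)).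
Proof.
move=> sc bc.
pose p := If (Var 1) (A3 sc (A1 hdz_c (Var 1))
  (Call2 (Var 0) (A1 tlz_c (Var 1)) (Var 2)) (Var 2)) (A1 bc (Var 2)).
have Hp F f l w a : kleene (compile id p) F f [:: compile id p, code l, w & a]
    (foldr (fun x v => s x v w) (b w) l).
  elim: l a => [|x l IH] a; apply: (@ev_kleene _ _ [:: _; _; _]).
    by apply: ev_if; [evt|by []|move=> _; evt].
  apply: ev_if; [evt|move=> _|by rewrite code_cons].
  apply: ev_A3; [evq; exact: hdz_code| |evt].
  by apply: ev_call2; [evt|evq; exact: tlz_code|evt|].
exists (fix_i p) => F f z w a; apply: kleene_fix.
by have := Hp F f (decode z) w a; rewrite decodeK.
Qed.

Lemma sizez_c : cfun1 (fun z => size (decode z)).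
Proof.
have sc : cfun3 (fun _ v _ => v.+1).
  by apply: (@mk3 _ (Suc (Var 1))) => F f x y z; evt.
apply: (@mk1 _ (A2 (fold_c sc (const_c 0)) (Var 0) (Cst 0))) => F f z.
by evq; elim: (decode z) => //= x l ->.
Qed.

Lemma memz_c : cfun2 (fun z x => x \in decode z).
Proof.
have sc : cfun3 (fun y v x => (x == y) || (v != 0)).
  apply: (@mk3 _ (A2 or_c (A2 eq_c (Var 2) (Var 0)) (Var 1))) => F f y v x.
  by evq; case: (x == y).
apply: (@mk2 _ (A2 (fold_c sc (const_c 0)) (Var 0) (Var 1))) => F f z x.
by evq; elim: (decode z) => //= y l ->; rewrite inE; case: (x \in l).
Qed.

(** By counting, a list of length k that contains all numbers below k is a permutation of them; this
    leaves a bounded check. *)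
Lemma perm_eq_iota (p : seq nat) :
  perm_eq p (iota 0 (size p)) = all (mem p) (iota 0 (size p)).
Proof.
apply/idP/allP => [/perm_mem E x|H]; first by rewrite -E.
have sz : size p <= size (iota 0 (size p)) by rewrite size_iota.
have [_ E] := uniq_min_size (iota_uniq 0 (size p)) H sz.
by rewrite perm_sym uniq_perm ?iota_uniq // (leq_size_uniq (iota_uniq 0 _) H).
Qed.

Lemma perm_forz_c : cfun2 (fun p s => perm_for (decode p) (decode s)).
Proof.
have sc : cfun3 (fun k v p => (k \in decode p) && (v != 0)).
  apply: (@mk3 _ (A2 and_c (A2 memz_c (Var 2) (Var 0)) (Var 1))) => F f k v p.
  by evq; case: (k \in _).
apply: (@mk2 _ (A2 and_c
   (A2 (nrec_c (const_c 1) sc) (A1 sizez_c (Var 0)) (Var 0))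
   (A2 le_c (A1 sizez_c (Var 0)) (A1 sizez_c (Var 1))))) => F f p s.
evq; rewrite /perm_for perm_eq_iota eqb0 negbK; congr (nat_of_bool (_ && _)).
elim: (size (decode p)) => // n IH.
rewrite -[in iota _ _]addn1 iotaD all_cat [nrec]lock /= -lock add0n andbT andbC -IH /=.
by rewrite eqb0 negbK; case: (nrec _ _ _ _) => // k; case: (n \in _).
Qed.

Definition permz p s :=
  foldr (fun i v => consz (nthz s i) v) (dropz (size (decode p)) s) (decode p).

(** [permz] reads 0 outside s where [permute] omits the entry; the side condition keeps all indices
    inside s. *)
Lemma permzE p s : perm_for p s -> permz (code p) (code s) = code (permute p s).
Proof.
move=> /andP[pp sp]; rewrite /permz /permute codeK /dropz codeK.
have ps : all (fun i => i < size s) p.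
  apply/allP => i; rewrite (perm_mem pp) mem_iota /= add0n => ip.
  exact: leq_trans sp.
move: (drop _ _) ps => l; elim: p {pp sp} => //= i p IH /andP[si /IH ->].
by rewrite /nthz codeK (onthE s) (nth_map 0).
Qed.

Lemma permz_c : cfun2 permz.
Proof.
have sc : cfun3 (fun i v w => consz (nthz (p1 w) i) v).
  apply: (@mk3 _ (A2 consz_c (A2 nthz_c (A1 p1_c (Var 2)) (Var 0)) (Var 1))).
  by move=> F f i v w; evt.
apply: (@mk2 _ (A2 (fold_c sc p2_c) (Var 0) (A2 pr_c (Var 1)
   (A2 dropz_c (A1 sizez_c (Var 0)) (Var 1))))) => F f p s.
by evq; rewrite /permz pr1 pr2.
Qed.

Lemma frontz_c : cfun1 (fun i => code (front i)).
Proof.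
have sc : cfun3 (fun k v _ => consz k.+1 v).
  by apply: (@mk3 _ (A2 consz_c (Suc (Var 0)) (Var 1))) => F f x y z; evt.
apply: (@mk1 _ (A2 (nrec_c (const_c (code [:: 0])) sc) (Var 0) (Cst 0))) => F f i.
evq; elim: i => //= i ->.
by rewrite /front -(addn1 i.+1) iotaD rev_cat /= add0n code_cons.
Qed.

Definition frontF e i := code [:: 6; e; code (front i); code [::]; code [::]].
Definition frontf e i := code [:: 6; e; code [::]; code (front i); code [::]].

Definition Code1 p := A2 consz_c p (Cst (code [::])).
Definition Code2 p q := A2 consz_c p (Code1 q).
Definition Code3 p q s := A2 consz_c p (Code2 q s).
Definition Code4 p q s t := A2 consz_c p (Code3 q s t).
Definition Code5 p q s t u := A2 consz_c p (Code4 q s t u).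

Lemma frontF_c : cfun2 frontF.
Proof.
apply: (@mk2 _ (Code5 (Cst 6) (Var 0) (A1 frontz_c (Var 1)) (Cst (code [::]))
  (Cst (code [::])))) => F f e i.
by evq.
Qed.

Lemma frontf_c : cfun2 frontf.
Proof.
apply: (@mk2 _ (Code5 (Cst 6) (Var 0) (Cst (code [::])) (A1 frontz_c (Var 1))
  (Cst (code [::])))) => F f e i.
by evq.
Qed.

Lemma proj_c : cfun1 proj.
Proof.
apply: (@mk1 _ (Code5 (Cst 6) (Cst (code [:: 3])) (Cst (code [::]))
   (Cst (code [::])) (A1 frontz_c (Var 0)))) => F f i.
by evq.
Qed.

Lemma nthz_code s n : nthz (code s) n = nth 0 s n.
Proof. by rewrite /nthz codeK. Qed.

Lemma consz_code x s : consz x (code s) = code (x :: s).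
Proof. by []. Qed.

Lemma code_eq s t : (code s == code t) = (s == t).
Proof. exact: (inj_eq code_inj). Qed.

Lemma code_eq0 s : (code s == 0) = nilp s.
Proof. by case: s => [|x s]; rewrite ?code_nil ?code_cons. Qed.

(** * The shape of an index *)

(** Rebuilding the code from its own entries checks tag and length at once. The values 82 and 83
    stand for S8.2 and S8.3, and 0 for numbers that are no index. *)
Definition kind e :=
  let n := nthz e in
  if e == code [:: 1] then 1 else
  if e == code [:: 2; n 1] then 2 else
  if e == code [:: 3] then 3 else
  if e == code [:: 4; n 1; n 2] then 4 else
  if e == code [:: 6; n 1; n 2; n 3; n 4] then 6 else
  if e == code [:: 7] then 7 else
  if e == code [:: 8; 2; n 2] then 82 else
  if e == code [:: 8; 3; n 2] then 83 else
  if e == code [:: 9] then 9 else 0.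

Lemma kindE :
  (kind (code [:: 1]) = 1) * (forall q, kind (code [:: 2; q]) = 2) *
  (kind (code [:: 3]) = 3) * (forall e1 e2, kind (code [:: 4; e1; e2]) = 4) *
  (forall e t1 t2 t3, kind (code [:: 6; e; t1; t2; t3]) = 6) *
  (kind (code [:: 7]) = 7) * (forall d, kind (code [:: 8; 2; d]) = 82) *
  (forall d, kind (code [:: 8; 3; d]) = 83) * (kind (code [:: 9]) = 9).
Proof.
by do !split=> *; rewrite /kind !nthz_code !code_eq /= ?eqxx ?eqseq_cons ?eqxx.
Qed.

Variant kind_spec : nat -> nat -> Prop :=
| Kind1 : kind_spec (code [:: 1]) 1
| Kind2 q : kind_spec (code [:: 2; q]) 2
| Kind3 : kind_spec (code [:: 3]) 3
| Kind4 e1 e2 : kind_spec (code [:: 4; e1; e2]) 4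
| Kind6 e p1 p2 p3 : kind_spec (code [:: 6; e; code p1; code p2; code p3]) 6
| Kind7 : kind_spec (code [:: 7]) 7
| Kind82 d : kind_spec (code [:: 8; 2; d]) 82
| Kind83 d : kind_spec (code [:: 8; 3; d]) 83
| Kind9 : kind_spec (code [:: 9]) 9
| Kind0 e : (forall F f a c, ~ kleene e F f a c) -> kind_spec e 0.

Lemma kindP e : kind_spec e (kind e).
Proof.
rewrite /kind.
case: eqP => [->|n1]; first exact: Kind1.
case: eqP => [->|n2]; first exact: Kind2.
case: eqP => [->|n3]; first exact: Kind3.
case: eqP => [->|n4]; first exact: Kind4.
case: eqP => [->|n6].
  rewrite -[nthz e 2]decodeK -[nthz e 3]decodeK -[nthz e 4]decodeK; exact: Kind6.
case: eqP => [->|n7]; first exact: Kind7.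
case: eqP => [->|n82]; first exact: Kind82.
case: eqP => [->|n83]; first exact: Kind83.
case: eqP => [->|n9]; first exact: Kind9.
have : kind e = 0 by rewrite /kind; do !case: eqP => //.
by move=> k0; constructor=> F f a c H; case: H k0 => >; rewrite kindE.
Qed.

Definition N p i := A2 nthz_c p (Cst i).
Definition Eq p q := A2 eq_c p q.

Lemma kind_c : cfun1 kind.
Proof.
pose e := Var 0; pose n := N e.
apply: (@mk1 _
  (If (Eq e (Cst (code [:: 1]))) (Cst 1)
  (If (Eq e (Code2 (Cst 2) (n 1))) (Cst 2)
  (If (Eq e (Cst (code [:: 3]))) (Cst 3)
  (If (Eq e (Code3 (Cst 4) (n 1) (n 2))) (Cst 4)
  (If (Eq e (Code5 (Cst 6) (n 1) (n 2) (n 3) (n 4))) (Cst 6)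
  (If (Eq e (Cst (code [:: 7]))) (Cst 7)
  (If (Eq e (Code3 (Cst 8) (Cst 2) (n 2))) (Cst 82)
  (If (Eq e (Code3 (Cst 8) (Cst 3) (n 2))) (Cst 83)
  (If (Eq e (Cst (code [:: 9]))) (Cst 9) (Cst 0))))))))))) => F f x.
rewrite /kind /=.
do 9! (apply: ev_if; [evt|
  rewrite /= ?consz_code; case: ifP => // _ _; exact: ev_cst|
  rewrite /= ?consz_code; case: ifP => // _ _]).
exact: ev_cst.
Qed.

Fixpoint Switch p (l : seq (nat * prog)) d :=
  if l is (k, q) :: l' then If (Eq p (Cst k)) q (Switch p l' d) else d.

Fixpoint lookup (k : nat) (l : seq (nat * prog)) d :=
  if l is (j, q) :: l' then if k == j then q else lookup k l' d else d.

Lemma ev_switch F f r p k l d c :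
  ev F f r p k -> ev F f r (lookup k l d) c -> ev F f r (Switch p l d) c.
Proof.
move=> Hp; elim: l => [|[j q] l IH] //= H.
apply: ev_if; first by evt.
  by move: H => /=; case: (k == j).
by move: H => /=; case: (k == j) => // + _.
Qed.

(** * Number quantification *)

(** S8.3 is used here since S8.2 would need a suitable functional in the list. The [Let] saves the
    prepended number, which p sees as variable 0. *)
Definition Ex p :=
  Ind (Cst 0) (Let (Hap (Cst 0)) (If p (Cst 1) (Hap (Suc (Suc (Var 0)))))).

(* The operator g |-> {n | phi n \/ g (n + 1)} spreads the truth of phi
   downwards to 0. *)
Lemma ev_ex F f r p (phi : nat -> bool) :
  (forall h n, ev F (h :: f) (n :: r) p (phi n)) ->
  ev F f r (Ex p) `[< exists n, phi n >].
Proof.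
move=> Hp; apply: (@ev_ind_total _ _ _ _ _ 0 _
  (fun u n => if phi n then 1 else u n.+1)); first exact: ev_cst.
  move=> u n; apply: ev_let; first by evq.
  apply: ev_if; first exact: Hp.
    by case: (phi n) => // _; apply: ev_cst.
  by case: (phi n) => // _; evq.
move=> g gr gc; congr nat_of_bool; apply/idP/asboolP => [|[n pn]].
  move: 0; elim/reach_ind: gr => {g gc} // [g k _ IH ->|X g IX gX] n.
    rewrite /cmax => /orP[/IH //|]; case: ifP => [pn _|_ ]; first by exists n.
    by rewrite eqb0 negbK => /IH.
  by move=> /gX[h /IX[_ H] /H].
have : g n by apply: gc; rewrite pn.
by elim: n {pn} => // n IH gn; apply: IH; apply: gc; case: ifP => //; rewrite gn.
Qed.

(** * Application of the functions and functionals in the lists *)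

Definition fnth (f : seq fcn) i := nth (fun=> 0) f i.
Definition Fnth (F : seq fnl) i := nth (fun=> 0) F i.

Definition Fap p q := Arg q (GoDyn (A2 frontf_c (Cst (code [:: 7])) p)).

Lemma ev_fap F f r p q i x : i < size f -> ev F f r p i -> ev F f r q x ->
  ev F f r (Fap p q) (fnth f i x).
Proof.
move=> fi Hp Hq; apply/evs0/(evs_arg Hq)/evs_godyn; first by evt.
move=> a /=; apply: KS6; rewrite ?perm_for_nil ?perm_for_front // !permute_nil.
have [f' ->] := permute_front_nth (fun=> 0 : nat) fi; exact: KS7.
Qed.

(* The subcomputations of S8.2 see the permuted list of functionals; they begin
   with permuting it back. *)
Definition ffap_body D :=
  compile id (Arg (Var 1) (Arg (Var 0) (GoDyn (A2 frontF_c (Cst D) (A1 p1_c (Var 1)))))).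

Definition FFap D p :=
  Arg p (GoDyn (A2 frontF_c (Cst (code [:: 8; 2; ffap_body D])) (A1 p1_c p))).

Lemma ev_ffap F f r D p w (g : fcn) : p1 w < size F -> ev F f r p w ->
  (forall x a, kleene D F f [:: x, w & a] (g x)) ->
  ev F f r (FFap D p) (Fnth F (p1 w) g).
Proof.
move=> Fw Hp HD; apply/evs0/(evs_arg Hp)/evs_godyn; first by evt.
move=> a /=; apply: KS6; rewrite ?perm_for_nil ?perm_for_front // !permute_nil.
have [F' FE] := permute_front_nth (fun=> 0 : nat) Fw.
rewrite FE; apply: KS82 => x; rewrite -FE.
apply: (@ev_kleene _ _ [:: x; w]).
apply/evs0; apply: evs_arg; [evt|apply: evs_arg; [evt|apply: evs_godyn; [evt|]]].
move=> b /=; apply: KS6; rewrite ?perm_for_nil ?perm_for_front ?size_permute_front //.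
by rewrite !permute_nil permute_frontK.
Qed.

(** * Virtual tuples *)

(* A number q describes a function in terms of the list f: the entry h of f at
   distance [p2 q] from the end if [p1 q] is 0, and n ^ (h 2, h 3, ..) if
   [p1 q] is n + 1. Counting from the end makes the description stable under
   the extension of f in S8.3. *)
Definition dfun (f : seq fcn) (q : nat) : fcn :=
  let h := fnth f (size f - (p2 q).+1) in
  if p1 q is n.+1 then prepend n (fun k => h k.+2) else h.

(** No scheme reads off the length of the list of functions, so it is carried along as a number. *)
Lemma dfun_c : {e | forall F f q x a, p2 q < size f ->
  kleene e F f [:: size f, q, x & a] (dfun f q x)}.
Proof.
pose pos := A2 sub_c (Var 0) (Suc (A1 p2_c (Var 1))).
exists (compile id (If (A1 p1_c (Var 1))
   (If (Var 2) (Fap pos (Suc (Var 2))) (A1 pred_c (A1 p1_c (Var 1))))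
   (Fap pos (Var 2)))) => F f q x a qf.
apply: (@ev_kleene _ _ [:: _; _; _]).
have Hpos : ev F f [:: size f; q; x] pos (size f - (p2 q).+1) by evt.
have posf : size f - (p2 q).+1 < size f by lia.
apply: ev_if; first by evt.
  rewrite /dfun /=; case E: (p1 q) => [|n] // _.
  apply: ev_if; [evt|move=> /= x0|by move=> /= ->; evq; rewrite E].
  by case: x x0 Hpos => // x _ Hpos; apply: ev_fap => //; evt.
by rewrite /dfun /= => ->; apply: ev_fap => //; evt.
Qed.

(** Positions count from the front here, since the list of functionals is never extended. *)
Definition repF F FI Fv :=
  all (fun i => i < size F) FI /\ [seq Fnth F i | i <- FI] = Fv.

Definition repf f fd fv :=
  all (fun q => p2 q < size f) fd /\ [seq dfun f q | q <- fd] = fv.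

Lemma permute_map (T U : Type) (h : T -> U) p s :
  permute p (map h s) = map h (permute p s).
Proof.
rewrite /permute map_cat -map_drop; congr (_ ++ _).
by elim: p => //= i p IH; rewrite onth_map; case: (onth s i) => //= x; rewrite IH.
Qed.

Lemma all_permute (T : Type) (P : pred T) p s : all P s -> all P (permute p s).
Proof.
move=> Ps; rewrite /permute all_cat; apply/andP; split; last first.
  by rewrite -[s](cat_take_drop (size p)) all_cat in Ps; case/andP: Ps.
elim: p => //= i p IH; case E: (onth s i) => [x|] //=; rewrite IH andbT.
by elim: s i Ps E {IH} => [|y s IH] [|i] //= /andP[Py Ps]; [case=> <-|apply: IH].
Qed.

Lemma perm_for_map (T U : Type) (h : T -> U) p s : perm_for p (map h s) = perm_for p s.
Proof. by rewrite /perm_for size_map. Qed.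

Lemma repF_permute p F FI Fv : repF F FI Fv -> repF F (permute p FI) (permute p Fv).
Proof. by move=> [FIF <-]; split; [apply: all_permute|rewrite permute_map]. Qed.

Lemma repf_permute p f fd fv : repf f fd fv -> repf f (permute p fd) (permute p fv).
Proof. by move=> [fdf <-]; split; [apply: all_permute|rewrite permute_map]. Qed.

Lemma dfun_cons h f q : p2 q < size f -> dfun (h :: f) q = dfun f q.
Proof. by move=> qf; rewrite /dfun /= subSn. Qed.

Lemma repf_cons h f fd fv : repf f fd fv -> repf (h :: f) fd fv.
Proof.
move=> [fdf <-]; split; first by apply: sub_all fdf => q /ltnW.
by elim: fd fdf => //= q fd IH /andP[qf /IH ->]; rewrite dfun_cons.
Qed.

Lemma repf_new h f fd fv k (q := pr k (size f)) :
  repf f fd fv -> repf (h :: f) (q :: fd) (dfun (h :: f) q :: fv).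
Proof.
move=> /(repf_cons h)[fdf <-]; split=> //=; by rewrite fdf /q pr2 ltnSn.
Qed.

Lemma dfun_new0 h f : dfun (h :: f) (pr 0 (size f)) = h.
Proof. by rewrite /dfun pr1 pr2 /= subnn. Qed.

(** In the comparison h is a number prepended to a stage (flag, g); dropping these two entries
    leaves g, to which n is prepended. *)
Lemma dfun_newS h f n : dfun (h :: f) (pr n.+1 (size f)) = prepend n (fun k => h k.+2).
Proof. by rewrite /dfun pr1 pr2 /= subnn. Qed.

Definition tcode e FI fd a := code [:: e; code FI; code fd; code a].

Definition T e FI fd a := Code4 e FI fd a.

Lemma ev_T F f r pe pFI pfd pa e FI fd a :
  ev F f r pe e -> ev F f r pFI (code FI) -> ev F f r pfd (code fd) ->
  ev F f r pa (code a) -> ev F f r (T pe pFI pfd pa) (tcode e FI fd a).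
Proof. by move=> *; apply: ev_eq; [evt|]. Qed.

(** * Evaluation of virtual tuples *)

Definition pidx X := N X 0.
Definition parg X i := N (N X 0) i.
Definition pFI X := N X 1.
Definition pfd X := N X 2.
Definition pnums X := N X 3.

(* Variables: 0 the argument of the functional, 1 the number built in the case
   S8.2 of [eval_prog]. *)
Definition eval82 :=
  let w := A1 p2_c (Var 1) in let z := A1 p1_c w in
  let nf := A1 p1_c (A1 p2_c w) in let X := A1 p2_c (A1 p2_c w) in
  compile id (Call2 z nf (T (parg X 2) (pFI X) (pfd X) (A2 consz_c (Var 0) (pnums X)))).

(* Variables: 0 the index of the program itself, 1 the length of the list of
   functions, 2 the virtual tuple. *)
Definition eval_prog :=
  let z := Var 0 in let nf := Var 1 in let X := Var 2 in
  Switch (A1 kind_c (pidx X))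
  [:: (1, Suc (A1 hdz_c (pnums X)));
      (2, parg X 1);
      (3, A1 hdz_c (pnums X));
      (4, Let (Call2 z nf (T (parg X 2) (pFI X) (pfd X) (pnums X)))
              (let z := Var 1 in let nf := Var 2 in let X := Var 3 in
               Call2 z nf (T (parg X 1) (pFI X) (pfd X)
                             (A2 consz_c (Var 0) (pnums X)))));
      (6, Call2 z nf (T (parg X 1) (A2 permz_c (parg X 2) (pFI X))
            (A2 permz_c (parg X 3) (pfd X)) (A2 permz_c (parg X 4) (pnums X))));
      (7, Arg (A1 hdz_c (pnums X)) (Arg (A1 hdz_c (pfd X)) (Arg nf (Go (sval dfun_c)))));
      (82, FFap eval82 (A2 pr_c (A1 hdz_c (pFI X)) (A2 pr_c z (A2 pr_c nf X))));
      (83, Ind (A1 hdz_c (pnums X))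
             (Call2 z (Suc nf) (T (parg X 2) (pFI X)
               (A2 consz_c (A2 pr_c (Cst 0) nf) (pfd X)) (A1 tlz_c (pnums X)))))]
  (Call2 z nf (T (A1 hdz_c (pnums X)) (pFI X) (pfd X) (A1 tlz_c (pnums X)))).

Definition eval_z := compile id eval_prog.

Ltac evv := eapply ev_eq; [evt|
  rewrite /= /tcode ?nthz_code /= ?nthz_code /= ?hdz_code ?tlz_code ?permzE //].

(** Simulating terminating computations is enough, as a comparison evaluates a tuple only once it is
    known to be in C_I. *)
Lemma kleene_eval e Fv fv av c : kleene e Fv fv av c ->
  forall F f FI fd a, repF F FI Fv -> repf f fd fv ->
  kleene eval_z F f [:: eval_z, size f, tcode e FI fd av & a] c.
Proof.
elim/kleene_strong_ind => {e Fv fv av c}.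
- move=> Fv fv a1 av F f FI fd a HF Hf; apply: (@ev_kleene _ _ [:: _; _; _]).
  apply: ev_switch; first by evv.
  rewrite kindE /=; evv.
- move=> q Fv fv av F f FI fd a HF Hf; apply: (@ev_kleene _ _ [:: _; _; _]).
  apply: ev_switch; first by evv.
  rewrite kindE /=; evv.
- move=> Fv fv a1 av F f FI fd a HF Hf; apply: (@ev_kleene _ _ [:: _; _; _]).
  apply: ev_switch; first by evv.
  rewrite kindE /=; evv.
- move=> e1 e2 Fv fv av b c _ IH2 _ IH1 F f FI fd a HF Hf.
  apply: (@ev_kleene _ _ [:: _; _; _]).
  apply: ev_switch; first by evv.
  rewrite kindE /=; apply: ev_let.
    by apply: ev_call2; [evt|evt|apply: ev_T; evv|move=> ?; exact: IH2].
  by apply: ev_call2; [evt|evt|apply: ev_T; evv|move=> ?; exact: IH1].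
- move=> e1 q1 q2 q3 Fv fv av c h1 h2 h3 _ IH F f FI fd a HF Hf.
  apply: (@ev_kleene _ _ [:: _; _; _]).
  apply: ev_switch; first by evv.
  have g1 : perm_for q1 FI by case: HF h1 => _ <-; rewrite perm_for_map.
  have g2 : perm_for q2 fd by case: Hf h2 => _ <-; rewrite perm_for_map.
  rewrite kindE /=; apply: ev_call2; [evt|evt|apply: ev_T; evv|move=> ?].
  by apply: IH; [apply: repF_permute|apply: repf_permute].
- move=> Fv f1 fv a1 av F f FI fd a HF Hf; apply: (@ev_kleene _ _ [:: _; _; _]).
  apply: ev_switch; first by evv.
  rewrite kindE /=; case: Hf; case: fd => // q fd /= /andP[qf _] [<- _].
  apply/evs0; do 3 (apply: evs_arg; first by evv).
  by apply: evs_go => ?; apply: (svalP dfun_c).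
- move=> d F1 Fv fv av g _ IH F f FI fd a HF Hf; apply: (@ev_kleene _ _ [:: _; _; _]).
  apply: ev_switch; first by evv.
  rewrite kindE /=; case: (HF); case: FI HF => // i FI HF /= /andP[iF _] [<- _].
  pose X := tcode (code [:: 8; 2; d]) (i :: FI) fd av.
  pose w := pr i (pr eval_z (pr (size f) X)).
  have -> : Fnth F i g = Fnth F (p1 w) g by rewrite pr1.
  apply: ev_ffap; [by rewrite pr1|by evv|move=> x b].
  apply: (@ev_kleene _ _ [:: _; _]).
  apply: ev_call2; [by evq; rewrite pr2 pr1|by evq; rewrite !pr2 pr1|
    apply: (@ev_T _ _ _ _ _ _ _ d (i :: FI) fd (x :: av)); (eapply ev_eq; [evt|]);
      rewrite /= !pr2 /X /tcode ?nthz_code /= ?nthz_code //|].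
  by move=> ?; apply: IH.
- move=> d Fv fv b av g Hg F f FI fd a HF Hf; apply: (@ev_kleene _ _ [:: _; _; _]).
  apply: ev_switch; first by evv.
  rewrite kindE /=; apply: ev_ind; first by evv.
  apply: ind_val_mono Hg => u v uv n; have [y [[_ IH] vy]] := uv n.
  exists y; split=> //.
  apply: ev_call2; [evt|evt| |move=> a'].
    by apply: (@ev_T _ _ _ _ _ _ _ d FI (pr 0 (size f) :: fd) av); evv.
  apply: (IH F (cprepend n u :: f)); first exact: HF.
  by have := repf_new (cprepend n u) 0 Hf; rewrite dfun_new0.
- move=> d Fv fv av c _ IH F f FI fd a HF Hf; apply: (@ev_kleene _ _ [:: _; _; _]).
  apply: ev_switch; first by evv.
  by rewrite kindE /=; apply: ev_call2; [evt|evt|apply: ev_T; evv|move=> ?; exact: IH].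
Qed.

(** * Stage comparison *)

Definition Not p := If p (Cst 0) (Cst 1).

Lemma ev_not F f r p (b : bool) : ev F f r p b -> ev F f r (Not p) (~~ b).
Proof. by move=> H; apply: ev_if H _ _; case: b => // _; apply: ev_cst. Qed.

Definition Eval nf X := Arg X (Arg nf (Arg (Cst eval_z) (Go eval_z))).

Lemma ev_eval F f r nf X e Fv fv av FI fd c :
  kleene e Fv fv av c -> repF F FI Fv -> repf f fd fv ->
  ev F f r nf (size f) -> ev F f r X (tcode e FI fd av) -> ev F f r (Eval nf X) c.
Proof.
move=> He HF Hf Hnf HX.
apply/evs0/(evs_arg HX)/(evs_arg Hnf); apply: evs_arg; first exact: ev_cst.
by apply: evs_go => a; apply: kleene_eval HF Hf.
Qed.

(* With h = n ^ (flag, g), [Hap (Cst 1)] is the flag, and n > 0 stands for the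
   number n - 1 of g. The operator of S8.3 is evaluated at g only after its
   subcomputations at g have been found to be below u, hence defined. *)
Definition body83 :=
  Let (Hap (Cst 0)) (If (Hap (Cst 1)) (Cst 0)
    (If (Ex (let z := Var 2 in let nf := Var 3 in let X := Var 4 in let Y := Var 5 in
           Call3 z (Suc (Suc nf)) Y (T (parg X 2) (pFI X)
             (A2 consz_c (A2 pr_c (Suc (Var 0)) nf) (pfd X)) (A1 tlz_c (pnums X)))))
        (If (Var 0) (Cst 0) (Cst 1))
        (let nf := Var 2 in let X := Var 3 in
         If (Var 0) (Eval (Suc nf) (T (parg X 2) (pFI X)
             (A2 consz_c (A2 pr_c (Var 0) nf) (pfd X)) (A1 tlz_c (pnums X)))) (Cst 0)))).

(* Variables: 0 the index of the program itself, 1 the length of the list of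
   functions, 2 and 3 the virtual tuples to be compared. *)
Definition comp_prog :=
  let z := Var 0 in let nf := Var 1 in let X := Var 2 in let Y := Var 3 in
  Switch (A1 kind_c (pidx X))
  [:: (1, If (pnums X) (Cst 1) (Cst 0));
      (2, Cst 1);
      (3, If (pnums X) (Cst 1) (Cst 0));
      (4, If (Call3 z nf Y (T (parg X 2) (pFI X) (pfd X) (pnums X))) (Cst 0)
            (Let (Eval nf (T (parg X 2) (pFI X) (pfd X) (pnums X)))
              (let z := Var 1 in let nf := Var 2 in let X := Var 3 in let Y := Var 4 in
               Not (Call3 z nf Y (T (parg X 1) (pFI X) (pfd X)
                                   (A2 consz_c (Var 0) (pnums X)))))));
      (6, If (A2 and_c (A2 perm_forz_c (parg X 2) (pFI X))
            (A2 and_c (A2 perm_forz_c (parg X 3) (pfd X))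
                      (A2 perm_forz_c (parg X 4) (pnums X))))
           (Not (Call3 z nf Y (T (parg X 1) (A2 permz_c (parg X 2) (pFI X))
              (A2 permz_c (parg X 3) (pfd X)) (A2 permz_c (parg X 4) (pnums X)))))
           (Cst 0));
      (7, If (A2 and_c (pfd X) (pnums X)) (Cst 1) (Cst 0));
      (82, If (pFI X)
            (Not (Ex (let z := Var 1 in let nf := Var 2 in let X := Var 3 in
               let Y := Var 4 in
               Call3 z (Suc nf) Y (T (parg X 2) (pFI X) (pfd X)
                                    (A2 consz_c (Var 0) (pnums X))))))
            (Cst 0));
      (83, If (pnums X) (Not (Ind (Cst 0) body83)) (Cst 0));
      (9, If (pnums X)
            (Not (Call3 z nf Y (T (A1 hdz_c (pnums X)) (pFI X) (pfd X)
                                 (A1 tlz_c (pnums X)))))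
            (Cst 0))]
  (Cst 0).

Definition comp_z := compile id comp_prog.

Definition lenorm t u := `[< ole (norm t) (norm u) >].

Lemma lenormN t u : ~~ lenorm t u <-> olt (norm u) (norm t).
Proof.
split=> [/asboolPn n|tu]; first by have [/n|] := ole_or_olt (norm t) (norm u).
by apply/asboolPn => ut; apply: ole_oltF ut tu.
Qed.

(** All presentations of t and u are covered, because the ambient list f grows under S8.3 and under
    [Ex]. *)
Definition correct t u := forall F f FI fd FI' fd' a,
  repF F FI (fnls t) -> repf f fd (fcns t) ->
  repF F FI' (fnls u) -> repf f fd' (fcns u) ->
  kleene comp_z F f [:: comp_z, size f, tcode (idx t) FI fd (nums t),
                        tcode (idx u) FI' fd' (nums u) & a] (lenorm t u).

Lemma ev_comp F f r t u z nf X Y FI fd FI' fd' : correct t u ->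
  repF F FI (fnls t) -> repf f fd (fcns t) ->
  repF F FI' (fnls u) -> repf f fd' (fcns u) ->
  ev F f r z comp_z -> ev F f r nf (size f) ->
  ev F f r X (tcode (idx t) FI fd (nums t)) ->
  ev F f r Y (tcode (idx u) FI' fd' (nums u)) ->
  ev F f r (Call3 z nf X Y) (lenorm t u).
Proof.
by move=> tu *; apply: ev_call3; try eassumption; move=> a; apply: tu.
Qed.

(** * Comparison at an instance of S8.3 *)

Section Comp83.

Variables (u : tup) (d : nat) (Fv : seq fnl) (fv : seq fcn) (b : nat) (av : seq nat).

Let t := Tup (code [:: 8; 3; d]) Fv fv (b :: av).
Let sub n g := Tup d Fv (cprepend n g :: fv) av.
Let G := FG Fv fv av d.

Hypothesis tu : in_CI t \/ in_CI u.
Hypothesis IH : forall t', (in_CI t -> olt (norm t') (norm t)) -> correct u t'.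

Variables (F : seq fnl) (f : seq fcn) (FI FI' fd fd' : seq nat).
Hypotheses (tF : repF F FI Fv) (tf : repf f fd fv).
Hypotheses (uF : repF F FI' (fnls u)) (uf : repf f fd' (fcns u)).

Let r := [:: comp_z; size f; tcode (code [:: 8; 3; d]) FI fd (b :: av);
             tcode (idx u) FI' fd' (nums u)].

Let fail n g := lenorm u (sub n g).
Let main (v : cantor) : cantor := fun k => v k.+1.
Let R := fpart (fun h y => ev F (h :: f) r body83 y).

Let Rf v k l : R v k -> R v l -> k = l.
Proof. by apply: fpart_fun => h y z; apply: ev_fun. Qed.

Let Gf v k l : G v k -> G v l -> k = l.
Proof. exact: fpart_kleene_fun. Qed.

Lemma comp83_sub g n : reach G g -> correct u (sub n g).
Proof.
by move=> gr; apply: IH => tC; apply: (norm_le83 (norm t) tC).1 => //; apply: ole_refl.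
Qed.

(** A norm strictly below another one is below [aleph1]; this is what makes evaluation safe after a
    passed test. *)
Lemma comp83_val g n : ~~ fail n g ->
  exists y, kleene d Fv (cprepend n g :: fv) av y.
Proof. by move=> /lenormN/norm_lt_CI. Qed.

Lemma comp83_flag (v : cantor) n : v 0 -> ev F (cprepend n v :: f) r body83 0.
Proof.
move=> v0; apply: ev_let; first by evt.
by apply: ev_if; [evt|move=> _; evt|rewrite /= v0].
Qed.

Lemma comp83_noflag (v : cantor) (n c : nat) : v 0 = false -> reach G (main v) ->
  ((exists k, fail k (main v)) -> c = (n == 0)) ->
  (~ (exists k, fail k (main v)) ->
     if n is k.+1 then kleene d Fv (cprepend k (main v) :: fv) av c else c = 0) ->
  ev F (cprepend n v :: f) r body83 c.
Proof.
move=> v0 vr c_fail c_nofail; apply: ev_let; first by evt.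
apply: ev_if; [evt|by rewrite /= v0|move=> _].
have tn h k : repf (h :: cprepend n v :: f) (pr k.+1 (size f) :: fd)
    (cprepend k (main v) :: fv).
  by apply: repf_cons; have := repf_new (cprepend n v) k.+1 tf; rewrite dfun_newS.
apply: ev_if.
- apply: (ev_ex (phi := fun k => fail k (main v))) => h k.
  apply: (@ev_comp _ _ _ u (sub k (main v)) _ _ _ _ FI' fd' FI (pr k.+1 (size f) :: fd)).
  + exact: comp83_sub.
  + exact: uF.
  + by do 2!apply: repf_cons.
  + exact: tF.
  + exact: tn.
  + by evt.
  + by evt.
  + by evt.
  + by apply: (@ev_T _ _ _ _ _ _ _ d FI (pr k.+1 (size f) :: fd) av); evv.
- move=> /eqP; rewrite eqb0 negbK => /asboolP/c_fail->.
  by apply: ev_if; [evt|case: n {c_fail c_nofail tn} => // n _; evt|move=> /= ->; evt].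
move=> /eqP; rewrite eqb0 => /asboolPn/c_nofail cE.
apply: ev_if; [evt| |] => /=; last by case: n cE {c_fail tn c_nofail} => // -> _; evt.
case: n cE c_fail tn {c_nofail} => // n cE _ _ _.
apply: (@ev_eval _ _ _ _ _ d Fv _ av FI (pr n.+1 (size f) :: fd) _ cE) => //.
- by have := repf_new (cprepend n.+1 v) n.+1 tf; rewrite dfun_newS.
- by evt.
- by apply: (@ev_T _ _ _ _ _ _ _ d FI (pr n.+1 (size f) :: fd) av); evv.
Qed.

Lemma comp83_R_fail (v k : cantor) : v 0 = false -> reach G (main v) ->
  (exists n, fail n (main v)) -> R v k -> k 0.
Proof.
move=> v0 vr vf /(_ 0)[y [Hy ky]].
have H : ev F (cprepend 0 v :: f) r body83 1 by apply: comp83_noflag.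
by move: ky; rewrite (ev_fun Hy H); case: (k 0).
Qed.

Lemma comp83_R_step (v k : cantor) : v 0 = false -> reach G (main v) ->
  ~ (exists n, fail n (main v)) -> R v k -> k 0 = false /\ G (main v) (main k).
Proof.
move=> v0 vr vf Rvk; split=> [|n].
  have [y [Hy ky]] := Rvk 0.
  have H : ev F (cprepend 0 v :: f) r body83 0 by apply: comp83_noflag.
  by move: ky; rewrite (ev_fun Hy H); case: (k 0).
have [y [Hy ky]] := Rvk n.+1; have [|c Hc] := @comp83_val (main v) n.
  by apply/negP => nf; apply: vf; exists n.
have H : ev F (cprepend n.+1 v :: f) r body83 c by apply: comp83_noflag.
by exists c; split=> //; rewrite -(ev_fun Hy H).
Qed.

(** While the flag is unset, the stages of [R] project onto those of [G] at the same ordinals. A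
    failure shows one step later, hence nothing is asserted about tests at [be] itself. *)
Lemma comp83_stage be v : stage R be v ->
  if v 0 then exists g n, reach G g /\ fail n g
  else stage G be (main v) /\
    forall g c, stage G c g -> olt c be -> forall n, ~~ fail n g.
Proof.
elim=> {be v} [be be0|be be' v k bb' bv IHv Rvk|be s v bl Hs IHs HR Hv].
- split=> [|g c _ cb]; first exact: stage_zero.
  by case: (ole_oltF (ole_trans be0.1 (ozero_le c)) cb).
- rewrite {1}/cmax; case v0: (v 0) IHv => //= -[Gv nofail].
  have vr : reach G (main v) by exists be'.
  have [vf|vf] := pselect (exists n, fail n (main v)).
    by rewrite (comp83_R_fail v0 vr vf Rvk); case: vf => n vn; exists (main v), n.
  have [-> Gvk] := comp83_R_step v0 vr vf Rvk.
  split; first exact: stage_succ bb' Gv Gvk.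
  move=> g c cg cb n; have : olt c (osucc be') by apply: oeq_lt cb.
  move=> /olt_osucc/ole_eqVlt[cb'|/nofail]; last exact.
  by apply/negP => gn; apply: vf; exists n; rewrite -(stage_fun Gf cg Gv cb').
- case v0: (v 0); first by have /Hv[c cb sc] := v0; have := IHs c cb; rewrite sc.
  have s0 c : olt c be -> s c 0 = false.
    move=> cb; apply/negP => sc; move: v0.
    by have /Hv -> : exists2 c, olt c be & s c 0 by exists c.
  have nofail c : olt c be -> stage G c (main (s c)) /\
      ~ (exists n, fail n (main (s c))) /\ exists k, G (main (s c)) k.
    move=> cb; have := IHs c cb; rewrite s0 // => -[Gs _]; split=> //.
    have [k Rk] := HR c cb; have sr : reach G (main (s c)) by exists c.
    have sf : ~ exists n, fail n (main (s c)).
      move=> sf; have k0 := comp83_R_fail (s0 c cb) sr sf Rk.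
      (* A failure at c sets the flag at the successor of c, and the set flag would persist up to
         the limit stage v. *)
      have cv : cle (cmax (s c) k) v.
        by apply: (stage_lt Rf (Hs c cb) Rk) cb; apply: stage_limit Hv.
      by move: (cv 0); rewrite /cmax k0 orbT v0.
    split=> //; exists (main k).
    by have [] := comp83_R_step (s0 c cb) sr sf Rk.
  split.
    apply: (@stage_limit _ _ (fun c => main (s c))) => // [c /nofail[]|c /nofail[_ []]|n] //.
    exact: Hv.
  move=> g c cg cb n; have [Gs [sf _]] := nofail c cb.
  by apply/negP => gn; apply: sf; exists n; rewrite -(stage_fun Gf cg Gs (oeq_refl c)).
Qed.

(** Passing all tests also certifies that t is in C_I: every subcomputation below u is defined, and
    [in_CI83] applies. *)
Lemma lenorm83 : lenorm t u <-> forall g n, reach G g -> ~~ fail n g.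
Proof.
split=> [/asboolP tu' g n gr|H].
  apply/lenormN; have tC := norm_le_CI tu tu'.
  by apply: (norm_le83 (norm u) tC).1.
apply/asboolP; have tC : in_CI t.
  by apply/in_CI83 => g n /H - /(_ n) /comp83_val.
by apply/(norm_le83 (norm u) tC) => g n gr; apply/lenormN/H.
Qed.

Lemma ev_comp83 : ev F f r (Not (Ind (Cst 0) body83)) (lenorm t u).
Proof.
rewrite -[lenorm t u]negbK; apply: ev_not; apply: ev_ind_reach.
- exact: ev_cst.
- move=> v n [be /comp83_stage]; case v0: (v 0).
    by exists 0; apply: comp83_flag.
  move=> [Gv _].
  have vr : reach G (main v) by exists be.
  have [vf|vf] := pselect (exists k, fail k (main v)).
    by exists (n == 0); apply: comp83_noflag.
  case: n => [|n]; first by exists 0; apply: comp83_noflag.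
  have [|y Hy] := @comp83_val (main v) n.
    by apply/negP => nf; apply: vf; exists n.
  by exists y; apply: comp83_noflag.
move=> v [be bv] vcl; congr nat_of_bool; have := comp83_stage bv.
case v0: (v 0).
  by move=> [g [n [gr gn]]]; apply/esym/negP => /lenorm83/(_ g n gr); rewrite gn.
move=> [Gv nofail]; apply/esym/negbF/lenorm83 => g n [c cg].
have vr : reach G (main v) by exists be.
have vf : ~ exists n, fail n (main v).
  move=> vf; have H : ev F (cprepend 0 v :: f) r body83 1 by apply: comp83_noflag.
  by have := vcl 0 1 H isT; rewrite v0.
(* Stages before [be] passed their tests; from [be] on, closure of v under [R] makes [main v] closed
   under [G], so g is [main v]. *)
have [bc|cb] := ole_or_olt be c; last exact: nofail cg cb n.
suff -> : g = main v by apply/negP => vn; apply: vf; exists n.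
have /choice[y Hy] k : exists y, kleene d Fv (cprepend k (main v) :: fv) av y.
  by apply: comp83_val; apply/negP => vk; apply: vf; exists k.
have Gy : G (main v) (fun k => y k != 0).
  by move=> k; exists (y k); split=> //; case: (y k) => // m; rewrite minnSS minn0.
apply: cle_anti; last exact: stage_ole Gf _ _ _ _ Gv cg bc.
apply: closed_above Gf _ _ _ _ _ Gv Gy _ cg.
apply/cleP => k yk; apply: (vcl k.+1 (y k)) => //.
by apply: comp83_noflag.
Qed.

End Comp83.

Lemma lenormP t u : lenorm t u <-> ole (norm t) (norm u).
Proof. by split=> /asboolP. Qed.

Lemma lenorm0 t u : in_CI t -> norm_rel t ozero -> lenorm t u = true.
Proof.
move=> tC /(norm_oeq tC)[t0 _]; apply/asboolP; exact: ole_trans t0 (ozero_le _).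
Qed.

Lemma lenorm_nCI t u : in_CI t \/ in_CI u -> ~ in_CI t -> lenorm t u = false.
Proof. by move=> tu nt; apply/asboolPn => /(norm_le_CI tu). Qed.

Lemma lenorm_iff t u (b : bool) : (lenorm t u <-> b) -> lenorm t u = b.
Proof. by move=> [h1 h2]; apply/idP/idP. Qed.

(** The bound on t' is offered only if t is in C_I; otherwise u is, and the call with u in first
    place is justified by the norm of u, whatever t' is. *)
Lemma correct_step t u : in_CI t \/ in_CI u ->
  (forall t', (in_CI t -> olt (norm t') (norm t)) -> correct u t') -> correct t u.
Proof.
case: t => e Fv fv av tu IH F f FI fd FI' fd' a /= tF tf uF uf.
apply: (@ev_kleene _ _ [:: _; _; _; _]).
apply: ev_switch; first by evv.
have nt H := lenorm_nCI tu H.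
case: (kindP e) tu IH nt => {e} [|q||e1 e2|e q1 q2 q3||d|d||e ne] tu IH nt.
- case: av tu IH nt => [|a1 av] tu IH nt /=.
    rewrite nt; last by case=> c /kleene_inv[? []] ? [].
    by apply: ev_if; [evv|by []|move=> _; evt].
  rewrite lenorm0; [|by eexists; apply: KS1|exact: NS1].
  by apply: ev_if; [evv|move=> _; evt|by rewrite code_cons].
- rewrite lenorm0; [exact: ev_cst|by eexists; apply: KS2|exact: NS2].
- case: av tu IH nt => [|a1 av] tu IH nt /=.
    rewrite nt; last by case=> c /kleene_inv[? []] ? [].
    by apply: ev_if; [evv|by []|move=> _; evt].
  rewrite lenorm0; [|by eexists; apply: KS3|exact: NS3].
  by apply: ev_if; [evv|move=> _; evt|by rewrite code_cons].
- set t := Tup _ _ _ _ in tu IH nt *; pose t2 := Tup e2 Fv fv av.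
  have tle : lenorm t u <-> olt (norm t2) (norm u) /\
      forall b, kleene e2 Fv fv av b -> olt (norm (Tup e1 Fv fv (b :: av))) (norm u).
    rewrite lenormP; apply: norm_le_iff tu => [|[/norm_lt_CI[b e2b] H]].
      exact: norm_le4.
    by have [c e1c] := norm_lt_CI (H b e2b); exists c; apply: KS4 e2b e1c.
  have t2u : correct u t2.
    by apply: IH => tC; have [] := (norm_le4 _ tC).1 (ole_refl _).
  apply: ev_if.
  + by apply: (ev_comp t2u uF uf tF tf); [evt|evt|evt|apply: ev_T; evv].
  + move=> /eqP; rewrite eqb0 negbK => ut2; rewrite (_ : lenorm t u = false).
      exact: ev_cst.
    by apply/negP => /tle[/lenormN]; rewrite ut2.
  (* Only now, with [t2] strictly below u, is it known that [e2] has a value to be computed. *)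
  move=> /eqP; rewrite eqb0 => /lenormN t2lt; have [b e2b] := norm_lt_CI t2lt.
  apply: (ev_let (b := b)).
    by apply: (ev_eval e2b tF tf); [evt|apply: ev_T; evv].
  have t1u : correct u (Tup e1 Fv fv (b :: av)).
    by apply: IH => tC; have [_] := (norm_le4 _ tC).1 (ole_refl _); apply.
  rewrite (_ : lenorm t u = ~~ lenorm u (Tup e1 Fv fv (b :: av))).
    by apply: ev_not; apply: (ev_comp t1u uF uf tF tf); [evt|evt|evt|apply: ev_T; evv].
  apply: lenorm_iff; rewrite tle lenormN; split=> [[_]|t1lt]; first exact.
  by split=> // b' /(kleene_fun e2b) <-.
- set t := Tup _ _ _ _ in tu IH nt *.
  pose t1 := Tup e (permute q1 Fv) (permute q2 fv) (permute q3 av).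
  (* Where S6 does not apply, t has norm [aleph1] and the answer must be 0. The side conditions
     depend on lengths only, so they can be tested on the descriptions. *)
  have [FE fE] : perm_for q1 FI = perm_for q1 Fv /\ perm_for q2 fd = perm_for q2 fv.
    by case: tF tf => _ <- [_ <-]; rewrite !perm_for_map.
  apply: (ev_if (b := perm_for q1 FI && (perm_for q2 fd && perm_for q3 av))).
  + by evv; rewrite !codeK !eqb0 !negbK.
  + move=> /eqP; rewrite eqb0 negbK => /and3P[p1F p2f p3a].
    have t1u : correct u t1.
      by apply: IH => tC; apply: (norm_le6 _ tC).1 (ole_refl _).
    rewrite (_ : lenorm t u = ~~ lenorm u t1).
      apply: ev_not; apply: (ev_comp t1u uF uf (repF_permute q1 tF) (repf_permute q2 tf)).
      - by evt.
      - by evt.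
      - by evt.
      - by apply: ev_T; evv.
    apply: lenorm_iff; rewrite lenormN lenormP; apply: norm_le_iff tu => [tC|].
      exact: norm_le6.
    move=> /norm_lt_CI[c e1c]; exists c; apply: KS6 e1c => //; first by rewrite -FE.
    by rewrite -fE.
  move=> /eqP; rewrite eqb0 => np; rewrite nt; first by evt.
  case=> c /kleene_inv[q1' [q2' [q3' [[]]]]] /code_inj<- /code_inj<- /code_inj<-.
  by case=> p1F p2f p3a _; move: np; rewrite FE fE p1F p2f p3a.
- apply: (ev_if (b := (fd != [::]) && (av != [::]))).
  + by evv; rewrite !code_eq0; case: (fd); case: (av).
  + move=> /eqP; rewrite eqb0 negbK => /andP[].
    case: tf tu IH nt => _ <- tu IH nt.
    case: fd av tu IH nt => [|q fd] [|a1 av] // tu IH nt _ _.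
    by rewrite lenorm0; [exact: ev_cst|eexists; apply: KS7|exact: NS7].
  move=> /eqP; rewrite eqb0 => n; rewrite nt; first by evt.
  case=> c /kleene_inv[f1 [f' [a1 [a' [fE aE _]]]]]; move: n.
  rewrite /= in fE aE; rewrite aE andbT.
  by case: tf => _; rewrite fE; case: (fd).
- set t := Tup _ _ _ _ in tu IH nt *.
  apply: ev_if; first by evv.
    move=> FI0; have [F1 [Fv' FvE]] : exists F1 Fv', Fv = F1 :: Fv'.
      by case: tF FI0 => _ <-; case: (FI) => // i FI1 _; do 2!eexists.
    rewrite FvE in t tu IH nt tF *.
    pose t1 b := Tup d (F1 :: Fv') fv (b :: av).
    have t1u b : correct u (t1 b).
      by apply: IH => tC; apply: (norm_le82 _ tC).1 (ole_refl _) b.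
    have -> : lenorm t u = ~~ `[< exists b, lenorm u (t1 b) >].
      apply: lenorm_iff; rewrite lenormP (_ : ~~ _ <-> forall b, olt (norm (t1 b)) (norm u)).
        apply: norm_le_iff tu => [tC|H]; first exact: norm_le82.
        have /choice[g Hg] b : exists c, kleene d (F1 :: Fv') fv (b :: av) c.
          exact: norm_lt_CI (H b).
        by exists (F1 g); apply: KS82.
      split=> [/asboolPn H b|H]; first by apply/lenormN/negP => ub; apply: H; exists b.
      by apply/asboolPn => -[b]; apply/negP/lenormN.
    apply: ev_not; apply: (ev_ex (phi := fun b => lenorm u (t1 b))) => h b.
    apply: (ev_comp (t1u b) uF (repf_cons h uf) tF (repf_cons h tf)).
    - by evt.
    - by evt.
    - by evt.
    - by apply: ev_T; evv.
  move=> FI0; rewrite nt; first by evt.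
  case=> c /kleene_inv[F1 [Fv' [g [FE _ _]]]].
  by rewrite /= in FE; case: tF; rewrite FE; case: (FI) FI0.
- apply: ev_if; first by evv.
    case: av tu IH nt => // b av tu IH nt _.
    exact: ev_comp83.
  case: av tu IH nt => // tu IH nt _; rewrite nt; first by evt.
  by case=> c /kleene_inv[? [? [? [? _ _]]]].
- apply: ev_if; first by evv.
    case: av tu IH nt => // d av tu IH nt _.
    set t := Tup _ _ _ _ in tu IH nt *; pose t1 := Tup d Fv fv av.
    have t1u : correct u t1.
      by apply: IH => tC; apply: (norm_le9 _ tC).1 (ole_refl _).
    rewrite (_ : lenorm t u = ~~ lenorm u t1).
      apply: ev_not; apply: (ev_comp t1u uF uf tF tf).
      - by evt.
      - by evt.
      - by evt.
      - by apply: ev_T; evv.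
    apply: lenorm_iff; rewrite lenormN lenormP; apply: norm_le_iff tu => [tC|].
      exact: norm_le9.
    by move=> /norm_lt_CI[c dc]; exists c; apply: KS9.
  case: av tu IH nt => // tu IH nt _; rewrite nt; first by evt.
  by case=> c /kleene_inv[? [? [? _]]].
- by rewrite nt; [exact: ev_cst|case=> c /ne].
Qed.

(** For t in C_I, one exchange leads to (u, v) with v below t and a second one to (v, w): the first
    entry has decreased and is still in C_I, so w may be arbitrary. If only u is in C_I, one
    exchange puts it first. *)
Lemma comp_correct t u : in_CI t \/ in_CI u -> correct t u.
Proof.
have left_case x t' u' : norm t' = x -> in_CI t' -> correct t' u'.
  elim/(well_founded_ind olt_wf): x t' u' => x IH t' u' tx tC; subst x.
  apply: correct_step => [|v /(_ tC) vt]; first by left.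
  have vC := norm_lt_CI vt.
  by apply: correct_step => [|w _]; [right|apply: IH vt _ _ erefl vC].
case=> [tC|uC]; first exact: left_case erefl tC.
by apply: correct_step => [|w _]; [right|apply: left_case erefl uC].
Qed.

(** * Decoding the input *)

(* The index of the program collecting the k numbers that precede position w;
   the position shifts by one once the rest of the list has been computed. *)
Definition gatherz := nrec (fun=> code [:: 2; 0])
  (fun k v w => code [:: 4; code [:: 4; sval consz_c; proj (w - k)]; v]).

Lemma gatherz_c : cfun2 gatherz.
Proof.
apply: nrec_c; first exact: const_c.
apply: (@mk3 _ (Code3 (Cst 4) (Code3 (Cst 4) (Cst (sval consz_c))
  (A1 proj_c (A2 sub_c (Var 2) (Var 0)))) (Var 1))) => F f k v w.
by evq.
Qed.

Lemma kleene_gatherz F f a k w : k <= w <= size a ->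
  kleene (gatherz k w) F f a (code (take k (drop (w - k) a))).
Proof.
elim: k => [|k IH] /andP[kw wa]; first by rewrite take0; apply: KS2.
have wk : w - k.+1 < size a by lia.
rewrite (drop_nth 0 wk) subnSK //= -consz_code; apply: KS4; first by apply: IH; lia.
apply: KS4; last exact: (svalP consz_c).
have := @kleene_proj F f (code (take k (drop (w - k) a)) :: a) (w - k) _.
by rewrite -subnSK //=; apply; lia.
Qed.

Lemma kleene_gather F f s1 s2 s3 :
  kleene (gatherz (size s2) (size s1 + size s2)) F f (s1 ++ s2 ++ s3) (code s2).
Proof.
have := @kleene_gatherz F f (s1 ++ s2 ++ s3) (size s2) (size s1 + size s2).
by rewrite addnK drop_size_cat // take_size_cat // !size_cat; apply; lia.
Qed.

(** Recursion builds the list from its last entry, so the parameter w is the upper end of the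
    segment. *)
Definition iotaz := nrec (fun=> code [::]) (fun k v w => consz (w - k.+1) v).

Lemma iotaz_c : cfun2 iotaz.
Proof.
apply: nrec_c; first exact: const_c.
apply: (@mk3 _ (A2 consz_c (A2 sub_c (Var 2) (Suc (Var 0))) (Var 1))) => F f k v w.
by evt.
Qed.

Lemma iotazE k s : iotaz k (s + k) = code (iota s k).
Proof.
rewrite /iotaz; set g := nrec _ _.
have gS j w : g j.+1 w = consz (w - j.+1) (g j w) by [].
suff E j : j <= k -> g j (s + k) = code (iota (s + k - j) j).
  by rewrite E // addnK.
elim: j => // j IH jk; rewrite gS IH ?(ltnW jk) //=.
by rewrite subnSK //; lia.
Qed.

(** Descriptions in the sense of [dfun]: [p1 w] is the upper end of the segment of functions, [p2 w]
    the length of the whole list. *)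
Definition descz := nrec (fun=> code [::])
  (fun k v w => consz (pr 0 (p2 w - (p1 w - k))) v).

Lemma descz_c : cfun2 descz.
Proof.
apply: nrec_c; first exact: const_c.
apply: (@mk3 _ (A2 consz_c (A2 pr_c (Cst 0) (A2 sub_c (A1 p2_c (Var 2))
  (A2 sub_c (A1 p1_c (Var 2)) (Var 0)))) (Var 1))) => F f k v w.
by evt.
Qed.

Lemma desczE k s n :
  descz k (pr (s + k) n) = code [seq pr 0 (n - j.+1) | j <- iota s k].
Proof.
rewrite /descz; set g := nrec _ _.
have gS j w : g j.+1 w = consz (pr 0 (p2 w - (p1 w - j))) (g j w) by [].
suff E j : j <= k ->
    g j (pr (s + k) n) = code [seq pr 0 (n - i.+1) | i <- iota (s + k - j) j].
  by rewrite E // addnK.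
elim: j => // j IH jk; rewrite gS IH ?(ltnW jk) // pr1 pr2 /=.
by rewrite subnSK //; lia.
Qed.

Lemma repF_cat F1 F2 F3 : repF (F1 ++ F2 ++ F3) (iota (size F1) (size F2)) F2.
Proof.
split; first by apply/allP => i; rewrite mem_iota !size_cat; lia.
apply: (@eq_from_nth _ (fun=> 0)); rewrite size_map size_iota // => i i2.
rewrite (nth_map 0) ?size_iota // nth_iota // /Fnth nth_cat.
by rewrite ltnNge leq_addr addKn /= nth_cat i2.
Qed.

Lemma repf_cat f1 f2 f3 (f := f1 ++ f2 ++ f3) :
  repf f [seq pr 0 (size f - j.+1) | j <- iota (size f1) (size f2)] f2.
Proof.
have fE : size f = size f1 + (size f2 + size f3) by rewrite !size_cat.
split.
  by rewrite all_map; apply/allP => i; rewrite mem_iota /= pr2; lia.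
apply: (@eq_from_nth _ (fun=> 0)); rewrite !size_map size_iota // => i i2.
rewrite (nth_map 0) ?size_map ?size_iota // (nth_map 0) ?size_iota // nth_iota //.
rewrite /dfun pr1 pr2 /fnth.
have -> : size f - (size f - (size f1 + i).+1).+1 = size f1 + i by lia.
by rewrite nth_cat ltnNge leq_addr addKn /= nth_cat i2.
Qed.

Lemma kleene_godyn F f r a p e c : ev F f r p e -> kleene e F f (r ++ a) c ->
  kleene (compile id (GoDyn p)) F f (r ++ a) c.
Proof. by move=> Hp He; apply: KS4 (ev_kleene a Hp) _; apply: KS9. Qed.

(** Each tuple contributes a header of four numbers and its n, respectively m, arguments, and
    earlier results are prepended. Hence the three segments end at 4 + n, 1 + 4 + n + 4 and 2 + 4 +
    n + 4 + m. *)
Definition input1 := GoDyn (A2 gatherz_c (Var 3) (A2 add_c (Cst 4) (Var 3))).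

Definition input2 := GoDyn (A2 gatherz_c (Cst 4) (A2 add_c (Cst 9) (Var 4))).

Definition input3 :=
  GoDyn (A2 gatherz_c (N (Var 0) 3)
    (A2 add_c (A2 add_c (Cst 10) (Var 5)) (N (Var 0) 3))).

(** Variables: 0 the coded arguments of the second tuple, 1 its coded header, 2 the coded arguments
    of the first tuple, from 3 on the header of the first. *)
Definition main_prog :=
  let U := Var 1 in let nf := A2 add_c (Var 5) (N U 2) in
  Call3 (Cst comp_z) nf
    (T (Var 3) (A2 iotaz_c (Var 4) (Var 4))
       (A2 descz_c (Var 5) (A2 pr_c (Var 5) nf)) (Var 2))
    (T (N U 0) (A2 iotaz_c (N U 1) (A2 add_c (Var 4) (N U 1)))
       (A2 descz_c (N U 2) (A2 pr_c nf nf)) (Var 0)).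

Definition main_z :=
  code [:: 4; code [:: 4; code [:: 4; compile id main_prog; compile id input3];
                   compile id input2]; compile id input1].

Lemma kleene_main t u : in_CI t \/ in_CI u ->
  kleene main_z (fnls t ++ fnls u) (fcns t ++ fcns u) (nums_of t ++ nums_of u)
    (lenorm t u).
Proof.
move=> tu; set F := fnls t ++ _; set f := fcns t ++ _.
have -> : nums_of t ++ nums_of u =
  [:: idx t; size (fnls t); size (fcns t); size (nums t)] ++
    nums t ++ [:: idx u; size (fnls u); size (fcns u); size (nums u)] ++ nums u.
  by rewrite /nums_of -!catA.
set h := [:: idx t; _; _; _]; set h' := [:: idx u; _; _; _].
apply: (@KS4 _ _ _ _ _ (code (nums t))).
  apply: (kleene_godyn (r := h)); first by evt.
  exact: (kleene_gather F f h).
apply: (@KS4 _ _ _ _ _ (code h')).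
  pose s := (code (nums t) :: h) ++ nums t.
  apply: (kleene_godyn (r := code (nums t) :: h) (e := gatherz 4 (size s + 4))).
    by evq; congr (gatherz 4 _); lia.
  by have := kleene_gather F f s h' (nums u); rewrite -!catA.
apply: (@KS4 _ _ _ _ _ (code (nums u))).
  pose s := [:: code h', code (nums t) & h] ++ nums t ++ h'.
  apply: (kleene_godyn (r := [:: code h', code (nums t) & h])
    (e := gatherz (size (nums u)) (size s + size (nums u)))).
    by evq; rewrite /s !nthz_code !size_cat /=; congr (gatherz _ _); lia.
  by have := kleene_gather F f s (nums u) [::]; rewrite cats0 -!catA.
apply: (@ev_kleene _ _ [:: code (nums u), code h', code (nums t) & h]).
have nfE : size f = size (fcns t) + size (fcns u) by rewrite size_cat.
have FE1 := repF_cat [::] (fnls t) (fnls u).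
have FE2 := repF_cat (fnls t) (fnls u) [::]; rewrite cats0 in FE2.
have fE1 := repf_cat [::] (fcns t) (fcns u).
have fE2 := repf_cat (fcns t) (fcns u) [::]; rewrite cats0 in fE2.
apply: (ev_comp (comp_correct tu) FE1 fE1 FE2 fE2).
- by evt.
- by evq; rewrite nthz_code nfE.
- apply: ev_T; first by evt.
  + by evq; rewrite -iotazE.
  + by evq; rewrite nthz_code /= -nfE -desczE.
  + by evt.
- apply: ev_T; first by evq; rewrite nthz_code.
  + by evq; rewrite nthz_code iotazE.
  + by evq; rewrite !nthz_code /= -nfE -desczE -nfE.
  + by evt.
Qed.

Theorem lemma2p13 :
  exists P : tup -> tup -> option nat,
    computable_in_I P /\
    forall t u : tup,
      in_CI t \/ in_CI u ->
      [/\ P t u <> None,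
          ole (norm t) (norm u) -> P t u = Some 1
        & olt (norm u) (norm t) -> P t u = Some 0].
Proof.
(* P is taken to be the partial function of [main_z] itself, so it may have any value or none where
   neither tuple is in C_I. *)
pose val t u c :=
  kleene main_z (fnls t ++ fnls u) (fcns t ++ fcns u) (nums_of t ++ nums_of u) c.
have /choice[P HP] (tu : tup * tup) :
    exists o, forall c, o = Some c <-> val tu.1 tu.2 c.
  have [[c vc]|nv] := pselect (exists c, val tu.1 tu.2 c).
    by exists (Some c) => d; split=> [[<-] //|/(kleene_fun vc)->].
  by exists None => c; split=> // vc; case: nv; exists c.
exists (fun t u => P (t, u)); split.
  by exists main_z => t u c; apply: (HP (t, u)).
move=> t u /kleene_main/(HP (t, u)) ->; split=> // [/lenormP->|/lenormN/negbTE->] //.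
Qed.
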